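(* Let $\alpha\in\mathbb{R}\setminus\mathbb{Q}$, $E\in\mathbb{R}$, and let $v(x)=\sum_{k=-d}^d\hat v_ke^{2\pi ikx}$, $w(x)=\sum_{k=-l}^l\hat w_ke^{2\pi ikx}$ be real-valued trigonometric polynomials with $\hat v_d\ne0$, $\hat w_l\ne0$. If there exists $H\in C^\omega(\mathbb{R}/\mathbb{Z},Sp_{2l\times2}(\mathbb{R}))$ such that $L^v_{E,w}(x)H(x)=H(x+\alpha)$ for all $x$, then the cocycle $(\alpha,L^w_{E,v})$ is not $PH2$.
   Context: For trigonometric polynomials $p(x)=\sum_{k=-m}^m\hat p_ke^{2\pi ikx}$ ($\hat p_m\ne0$) and $q$, the finite-range operator is $(L^q_{p,\alpha,x}u)_n=\sum_{k=-m}^m\hat p_ku_{n+k}+q(x+n\alpha)u_n$, and $L^q_{E,p}(x)$ denotes the $2m\times2m$ transfer matrix of $L^q_{p,\alpha,x}u=Eu$: its first row is $\frac1{\hat p_m}(-\hat p_{m-1},\dots,-\hat p_1,E-q(x)-\hat p_0,-\hat p_{-1},\dots,-\hat p_{-m})$ and its $(j+1)$-th row is $e_j^T$ ($j=1,\dots,2m-1$). Thus $L^w_{E,v}$ is $2d\times2d$ and $L^v_{E,w}$ is $2l\times2l$. Let $C_w$ be the $l\times l$ upper triangular matrix with $(C_w)_{ij}=\hat w_{l-j+i}$ for $j\ge i$, $S_w=\begin{pmatrix}0&-C_w^*\\C_w&0\end{pmatrix}$, $J=\begin{pmatrix}0&1\\-1&0\end{pmatrix}$, and $Sp_{2l\times2}(\mathbb{R})=\{F\in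 M_{2l\times2}(\mathbb{R}):F^*S_wF=J\}$. A cocycle $(\alpha,A)$ on $\mathbb{C}^m$ is $k$-dominated if there is a continuous invariant splitting $\mathbb{C}^m=E^+(x)\oplus E^-(x)$, $\dim E^+=k$, and $N\ge1$ with $\|A_N(x)u\|>\|A_N(x)u'\|$ for all $x$ and unit $u\in E^+(x)$, $u'\in E^-(x)$, $A_N(x)=A(x+(N-1)\alpha)\cdots A(x)$. A $2d$-dimensional cocycle is $PH2$ if it is $(d-1)$- and $(d+1)$-dominated. *)

(* Defs.v *)
From HB Require Import structures.
From mathcomp Require Import all_boot all_order all_algebra.
From mathcomp Require Import all_classical all_reals all_analysis.
From mathcomp Require Import complex.
Set Implicit Arguments. Unset Strict Implicit. Unset Printing Implicit Defensive.
Import Order.TTheory GRing.Theory Num.Theory.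
Import numFieldNormedType.Exports.
Local Open Scope ring_scope.
Local Open Scope complex_scope.
Local Open Scope classical_set_scope.

Section Defs.
Variable R : realType.
Local Notation C := (R[i]).

Definition cexp2pi (k : int) (x : R) : C :=
  Complex (cos (2 * pi * k%:~R * x)) (sin (2 * pi * k%:~R * x)).

Definition trig_eval (m : nat) (ph : int -> C) (x : R) : C :=
  \sum_(j < (m + m).+1) ph (j%:Z - m%:Z) * cexp2pi (j%:Z - m%:Z) x.

Definition trig_real_valued (m : nat) (ph : int -> C) : Prop :=
  forall x : R, complex.Im (trig_eval m ph x) = 0.

(* transfer matrix L^q_{E,p}(x), of size 2m x 2m (written m + m).
   First row: (1/ph m) (-ph (m-1), ..., -ph 1, E - q x - ph 0, -ph (-1), ..., -ph (-m)),
   i.e. column j carries index k = m - 1 - j. Row i+1 is e_{i+1}^T (1-indexed). *)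
Definition transfer (m : nat) (ph : int -> C) (qx : C) (E : R) : 'M[C]_(m + m) :=
  \matrix_(i < m + m, j < m + m)
    if (i : nat) == 0%N then
      (let k := (m%:Z - 1 - j%:Z)%R in
       (if k == 0 then E%:C - qx - ph 0 else - ph k) / ph m%:Z)
    else ((j : nat) == i.-1)%:R.

Definition transfer_fun (m : nat) (ph : int -> C) (n : nat) (qh : int -> C) (E : R)
  (x : R) : 'M[C]_(m + m) := transfer m ph (trig_eval n qh x) E.

Definition Cmat (l : nat) (wh : int -> C) : 'M[C]_l :=
  \matrix_(i < l, j < l) if (i <= j)%N then wh (l%:Z - j%:Z + i%:Z) else 0.

Definition conjT (p q : nat) (A : 'M[C]_(p, q)) : 'M[C]_(q, p) :=
  (map_mx (@conjc R) A)^T.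

Definition Smat (l : nat) (wh : int -> C) : 'M[C]_(l + l) :=
  block_mx 0 (- conjT (Cmat l wh)) (Cmat l wh) 0.

Definition Jmat : 'M[C]_2 :=
  \matrix_(i < 2, j < 2)
    if ((i : nat) == 0%N) && ((j : nat) == 1%N) then 1
    else if ((i : nat) == 1%N) && ((j : nat) == 0%N) then -1 else 0.

Definition cmx (p q : nat) (A : 'M[R]_(p, q)) : 'M[C]_(p, q) :=
  map_mx (fun r : R => r%:C) A.

Definition in_Sp (l : nat) (wh : int -> C) (F : 'M[R]_(l + l, 2)) : Prop :=
  conjT (cmx F) *m Smat l wh *m cmx F = Jmat.

Definition real_analytic (f : R -> R) : Prop :=
  forall x0 : R, exists r : R, 0 < r /\ exists c : nat -> R,
    forall x : R, `|x - x0| < r ->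
      (fun n : nat => \sum_(j < n) c j * (x - x0) ^+ j) @ \oo --> f x.

Definition analytic_periodic_mx (p q : nat) (H : R -> 'M[R]_(p, q)) : Prop :=
  (forall x, H (x + 1) = H x) /\
  (forall i j, real_analytic (fun x => H x i j)).

Definition ccontinuous (f : R -> C) : Prop :=
  continuous (fun x => complex.Re (f x)) /\ continuous (fun x => complex.Im (f x)).

Definition normsq (m : nat) (u : 'cV[C]_m) : R :=
  \sum_(i < m) (complex.Re (u i 0) ^+ 2 + complex.Im (u i 0) ^+ 2).

Definition in_sub (m : nat) (u : 'cV[C]_m) (M : 'M[C]_m) : bool :=
  (u^T <= M)%MS.

Fixpoint cocycle_iter (m : nat) (alpha : R) (A : R -> 'M[C]_m) (N : nat) (x : R)
  : 'M[C]_m :=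
  match N with
  | 0%N => 1%:M
  | N'.+1 => A (x + N'%:R * alpha) *m cocycle_iter alpha A N' x
  end.

(* continuity of a subspace-valued map (subspaces = row spaces): locally it is
   spanned by the rows of a continuous matrix-valued function (local continuous frame) *)
Definition subspace_continuous (m : nat) (Ef : R -> 'M[C]_m) : Prop :=
  forall x0 : R, exists delta : R, 0 < delta /\
    exists B : R -> 'M[C]_m,
      (forall i j, ccontinuous (fun x => B x i j)) /\
      (forall x, `|x - x0| < delta -> (B x == Ef x)%MS).

Definition dominated (m : nat) (alpha : R) (A : R -> 'M[C]_m) (k : nat) : Prop :=
  exists Ep Em : R -> 'M[C]_m,
    (forall x, Ep (x + 1) = Ep x /\ Em (x + 1) = Em x) /\
    subspace_continuous Ep /\ subspace_continuous Em /\
    (forall x, (Ep x :&: Em x == (0 : 'M[C]_m))%MS /\ (Ep x + Em x == 1%:M)%MS) /\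
    (forall x, \rank (Ep x) = k) /\
    (forall x, (Ep x *m (A x)^T == Ep (x + alpha)%R)%MS /\
               (Em x *m (A x)^T == Em (x + alpha)%R)%MS) /\
    exists N : nat, (1 <= N)%N /\
      forall x (u u' : 'cV[C]_m),
        in_sub u (Ep x) -> normsq u = 1 ->
        in_sub u' (Em x) -> normsq u' = 1 ->
        normsq (cocycle_iter alpha A N x *m u') < normsq (cocycle_iter alpha A N x *m u).

Definition PH2 (d : nat) (alpha : R) (A : R -> 'M[C]_(d + d)) : Prop :=
  dominated alpha A d.-1 /\ dominated alpha A d.+1.

End Defs.

(* Main.v *)
(* Write g for a column of H read along the row that makes it a solution of
   sum_k w_k g(x + k alpha) + v(x) g(x) = E g(x). Taking Fourier coefficients
   turns the two columns of H into two solutions of the dual equation along the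
   orbit of phase 0, hence into two orbits of the cocycle (alpha, L^w_{E,v})
   defined for all times n in Z, which tend to 0 as n -> +-oo by the
   Riemann-Lebesgue lemma and are linearly independent at time 0 because the
   columns of H are.

   The cocycle preserves the nondegenerate form S_v. A linear map preserving it
   cannot be uniformly expanding or uniformly contracting by a large factor on a
   subspace of dimension d + 1, so that domination at d + 1 makes the bundle E^-
   of dimension d - 1 uniformly contracted, and domination at d - 1 makes the
   bundle E^+ of dimension d - 1 uniformly expanded. The plane V spanned by the
   two orbits at time 0 is then S_v-orthogonal to itself, to E^- and to E^+; as
   E^+ + E^- has dimension 2d - 2 it is the orthogonal of V, so that V is
   contained in E^+ + E^-. But a vector of E^+ + E^- whose orbit is bounded in
   both time directions vanishes. *)
Require Import Defs.
From HB Require Import structures.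
From mathcomp Require Import all_boot all_order all_algebra.
From mathcomp Require Import all_classical all_reals all_analysis.
From mathcomp Require Import complex.
From mathcomp Require Import ring lra zify.
Import Order.TTheory GRing.Theory Num.Theory.
Import numFieldNormedType.Exports.
Local Open Scope ring_scope.
Local Open Scope complex_scope.

(** * Squared norms and sesquilinear forms *)

Section SquaredNorm.
Context {R : realType}.
Local Notation C := R[i].

(** Domination only provides a strict inequality, fibre by fibre and for forward iterates.
    Compactness turns it into a ratio below 1 that is uniform in the phase, and backward statements
    are obtained by starting at phase -k alpha and returning to phase 0. The E^+ and E^- combined at
    the end belong to two different splittings, so that their independence has to be deduced from
    their opposite rates. A complex dependence between the two orbits at time 0 persists at all
    times, the cocycle being invertible; it therefore annihilates every Fourier coefficient of a
    complex combination of two real functions. Uniqueness of Fourier coefficients makes it a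
    relation between these functions, hence between the columns of H at 0, which F^* S_w F = J
    excludes. Integrals over the circle are increments of primitives, so that estimates on them come
    from the mean value theorem. Constants are crude, since only rates matter. *)

Definition sqc (z : C) : R := complex.Re z ^+ 2 + complex.Im z ^+ 2.

Lemma normsqE {m : nat} (u : 'cV[C]_m) : normsq u = \sum_(i < m) sqc (u i 0).
Proof. by []. Qed.

Lemma sqc_ge0 z : 0 <= sqc z.
Proof. by rewrite addr_ge0 ?sqr_ge0. Qed.

Lemma sqc_eq0 z : (sqc z == 0) = (z == 0).
Proof. by case: z => a b; rewrite /sqc paddr_eq0 ?sqr_ge0 // !sqrf_eq0 eq_complex. Qed.

Lemma sqcM x y : sqc (x * y) = sqc x * sqc y.
Proof. by case: x y => [a b] [c d]; rewrite /sqc /=; ring. Qed.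

Lemma sqc_conj x : sqc x^* = sqc x.
Proof. by case: x => [a b]; rewrite /sqc /= sqrrN. Qed.

Lemma sqc0 : sqc 0 = 0.
Proof. by apply/eqP; rewrite sqc_eq0. Qed.

Lemma sqcD x y : sqc (x + y) <= 2 * (sqc x + sqc y).
Proof.
case: x y => [a b] [c d]; rewrite /sqc /=.
have := sqr_ge0 (a - c); have := sqr_ge0 (b - d); nra.
Qed.

(** The factor [2 ^+ n] comes from iterating [sqcD], which stands in for the Cauchy-Schwarz
    inequality. *)
Lemma sqc_sum {n} (F : 'I_n -> C) :
  sqc (\sum_i F i) <= 2 ^+ n * \sum_i sqc (F i).
Proof.
elim: n F => [|n IH] F; first by rewrite !big_ord0 sqc0 mulr0.
rewrite !big_ord_recl (le_trans (sqcD _ _)) // exprS -mulrA ler_pM2l //.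
rewrite mulrDr lerD //.
by rewrite ler_peMl ?sqc_ge0 // exprn_ege1 // ler1n.
Qed.

Lemma normsq_ge0 {m} (u : 'cV[C]_m) : 0 <= normsq u.
Proof. by rewrite normsqE sumr_ge0 // => i _; exact: sqc_ge0. Qed.

Lemma normsq_eq0 {m} (u : 'cV[C]_m) : (normsq u == 0) = (u == 0).
Proof.
rewrite normsqE psumr_eq0; last by move=> i _; exact: sqc_ge0.
apply/allP/eqP => [h|-> i _ /=]; last by rewrite mxE sqc0.
apply/matrixP => i j; rewrite ord1 mxE; apply/eqP; rewrite -sqc_eq0.
exact: (h i (mem_index_enum i)).
Qed.

Lemma normsq0 {m} : normsq (0 : 'cV[C]_m) = 0.
Proof. by apply/eqP; rewrite normsq_eq0. Qed.

Lemma normsq_gt0 {m} (u : 'cV[C]_m) : u != 0 -> 0 < normsq u.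
Proof. by move=> u0; rewrite lt_def normsq_ge0 normsq_eq0 u0. Qed.

Lemma normsqZ {m} c (u : 'cV[C]_m) : normsq (c *: u) = sqc c * normsq u.
Proof.
by rewrite !normsqE mulr_sumr; apply: eq_bigr => i _; rewrite mxE sqcM.
Qed.

Lemma normsqD {m} (u w : 'cV[C]_m) :
  normsq (u + w) <= 2 * (normsq u + normsq w).
Proof.
rewrite !normsqE -big_split mulr_sumr ler_sum //= => i _.
by rewrite mxE sqcD.
Qed.

Lemma normsq_ge_coord {m} (u : 'cV[C]_m) i : sqc (u i 0) <= normsq u.
Proof.
by rewrite normsqE (bigD1 i) //= lerDl sumr_ge0 // => j _; exact: sqc_ge0.
Qed.

Lemma normsq_mulmx_bound {m n} (M : 'M[C]_(m, n)) :
  exists2 K : R, 0 < K & forall u, normsq (M *m u) <= K * normsq u.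
Proof.
(* The summand 1 keeps the constant positive when M vanishes. *)
exists (1 + \sum_i \sum_j 2 ^+ n * sqc (M i j)) => [|u].
  rewrite ltr_pwDl // sumr_ge0 // => i _; rewrite sumr_ge0 // => j _.
  by rewrite mulr_ge0 ?exprn_ge0 ?sqc_ge0.
apply: (@le_trans _ _ ((\sum_i \sum_j 2 ^+ n * sqc (M i j)) * normsq u)).
  rewrite [normsq (_ *m _)]normsqE mulr_suml ler_sum // => i _.
  rewrite mxE (le_trans (sqc_sum _)) // mulr_suml mulr_sumr ler_sum // => j _.
  by rewrite sqcM mulrA ler_wpM2l ?mulr_ge0 ?exprn_ge0 ?sqc_ge0 // normsq_ge_coord.
by rewrite mulrDl mul1r lerDr normsq_ge0.
Qed.

(** * Conjugate transposes and sesquilinear forms *)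

Lemma conjTM {m n p} (A : 'M[C]_(m, n)) (B : 'M[C]_(n, p)) :
  conjT (A *m B) = conjT B *m conjT A.
Proof. by rewrite /conjT map_mxM trmx_mul. Qed.

Lemma conjT_mxE {m n} (A : 'M[C]_(m, n)) i j : conjT A i j = (A j i)^*.
Proof. by rewrite !mxE. Qed.

Lemma conjT_unit {m} (A : 'M[C]_m) : (conjT A \in unitmx) = (A \in unitmx).
Proof. by rewrite /conjT unitmx_tr map_unitmx. Qed.

Lemma normsq_conjT {m} (u : 'cV[C]_m) : (conjT u *m u) 0 0 = (normsq u)%:C.
Proof.
rewrite mxE normsqE rmorph_sum; apply: eq_bigr => i _.
rewrite conjT_mxE; case: (u i 0) => a b; rewrite /sqc.
by apply/eqP; rewrite eq_complex /=; apply/andP; split; apply/eqP; ring.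
Qed.

Definition sform {m} (S : 'M[C]_m) (u w : 'cV[C]_m) : C := (conjT u *m S *m w) 0 0.

Lemma sform_bound {m} (S : 'M[C]_m) :
  exists2 K : R, 0 < K &
    forall u w, sqc (sform S u w) <= K * (normsq u * normsq w).
Proof.
have [K K0 HK] := normsq_mulmx_bound S.
exists (2 ^+ m * K) => [|u w]; first by rewrite mulr_gt0 ?exprn_gt0.
rewrite /sform -mulmxA mxE (le_trans (sqc_sum _)) // -mulrA.
rewrite ler_pM2l ?exprn_gt0 // mulrCA.
apply: (@le_trans _ _ (normsq u * normsq (S *m w))); last first.
  by rewrite ler_wpM2l ?normsq_ge0.
rewrite [normsq (_ *m _)]normsqE mulr_sumr ler_sum // => i _.
by rewrite sqcM conjT_mxE sqc_conj ler_wpM2r ?sqc_ge0 // normsq_ge_coord.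
Qed.

Lemma sform_mul {m} (S M : 'M[C]_m) u w : conjT M *m S *m M = S ->
  sform S (M *m u) (M *m w) = sform S u w.
Proof. by move=> h; rewrite /sform conjTM -{2}h !mulmxA. Qed.

Lemma sform_inv {m} (S M : 'M[C]_m) : M \in unitmx -> conjT M *m S *m M = S ->
  conjT (invmx M) *m S *m invmx M = S.
Proof.
move=> uM h; rewrite -{1}h -!mulmxA mulmxV // mulmx1 mulmxA -conjTM mulmxV //.
by rewrite /conjT map_mx1 trmx1 mul1mx.
Qed.

Lemma sform_unit {m} (S M : 'M[C]_m) : S \in unitmx -> conjT M *m S *m M = S ->
  M \in unitmx.
Proof.
move=> uS h; move: uS; rewrite -h !unitmx_mul => /andP[_]; exact.
Qed.

(* A subspace G of dimension greater than m/2 meets S G; for w in G with S w in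
   G the form takes the value |S w|^2 on (S w, w), so that an isometry of the
   form cannot shrink both vectors much. *)
Lemma exists_slow_vector {m} (S : 'M[C]_m) : S \in unitmx ->
  exists2 K : R, 0 < K & forall (M : 'M[C]_m) p (F : 'M[C]_(p, m)),
    conjT M *m S *m M = S -> (m < \rank F + \rank F)%N ->
    exists u : 'cV_m, [/\ (u^T <= F)%MS, u != 0 & normsq (M *m u) <= K * normsq u].
Proof.
move=> uS.
have [K1 K10 HK1] := sform_bound S.
have [K2 K20 HK2] := normsq_mulmx_bound (invmx S).
pose K := 1 + K1 * K2; exists K => [|M p F hM hF].
  by rewrite addr_gt0 ?mulr_gt0.
have uM := sform_unit _ _ uS hM.
pose G := F *m M^T.
have rG : \rank G = \rank F by rewrite mxrankMfree // row_free_unit unitmx_tr.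
have rSG : \rank (G *m S^T) = \rank F.
  by rewrite mxrankMfree // row_free_unit unitmx_tr.
have : (G :&: G *m S^T)%MS != 0.
  rewrite -mxrank_eq0; have := mxrank_sum_cap G (G *m S^T).
  have := rank_leq_col (G + G *m S^T)%MS.
  rewrite rG rSG; move: (\rank (_ + _)%MS) (\rank (_ :&: _)%MS) => a b; lia.
case/rowV0Pn => z; rewrite sub_capmx => /andP[zG /submxP[D zE]] z0.
pose w := (D *m G)^T.
have zw : z^T = S *m w by rewrite zE mulmxA trmx_mul trmxK.
have wG : (w^T <= G)%MS by rewrite trmxK submxMl.
pose u1 := invmx M *m z^T; pose u2 := invmx M *m w.
have inF (x : 'cV_m) : (x^T <= G)%MS -> ((invmx M *m x)^T <= F)%MS.
  move=> /submxP[D' hx].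
  by rewrite trmx_mul hx /G -!mulmxA -trmx_mul mulVmx // trmx1 mulmx1 submxMl.
have Mu1 : M *m u1 = z^T by rewrite /u1 mulmxA mulmxV // mul1mx.
have Mu2 : M *m u2 = w by rewrite /u2 mulmxA mulmxV // mul1mx.
have zT0 : z^T != 0 by rewrite trmx_eq0.
have w0 : w != 0 by apply: contraNneq zT0 => w0; rewrite zw w0 mulmx0.
have u10 : u1 != 0 by apply: contraNneq zT0 => h; rewrite -Mu1 h mulmx0.
have u20 : u2 != 0 by apply: contraNneq w0 => h; rewrite -Mu2 h mulmx0.
have Hf : sform S u1 u2 = (normsq z^T)%:C.
  by rewrite -(sform_mul _ _ _ _ hM) Mu1 Mu2 /sform -mulmxA -zw normsq_conjT.
have bound : normsq z^T * normsq w <= K1 * K2 * (normsq u1 * normsq u2).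
  have h1 := HK1 u1 u2; have h2 := HK2 (z^T).
  rewrite {1}zw mulmxA mulVmx // mul1mx in h2.
  rewrite Hf /sqc /= expr0n /= addr0 in h1.
  apply: (@le_trans _ _ (normsq z^T * (K2 * normsq z^T))).
    by rewrite ler_wpM2l ?normsq_ge0.
  by rewrite mulrCA -expr2 (mulrC K1) -[leRHS]mulrA ler_pM2l.
(* If M stretched both u1 and u2 by more than K, then [bound] would give K^2 < K1 K2, which is
   impossible for K = 1 + K1 K2. *)
have [h|h] := lerP (normsq z^T) (K * normsq u1).
  exists u1; split; [|exact: u10|by rewrite Mu1].
  by apply: inF; rewrite trmxK.
exists u2; split; [exact: inF|exact: u20|].
rewrite Mu2 leNgt; apply/negP => h'.
have := normsq_gt0 _ u10; have := normsq_gt0 _ u20.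
move: bound h h'; rewrite /K; have : 0 < K1 * K2 by rewrite mulr_gt0.
move: (normsq z^T) (normsq w) (normsq u1) (normsq u2) (K1 * K2) => a b c d k.
move=> k0 bound ha hb d0 c0.
have k1 : 0 < 1 + k by rewrite addr_gt0.
have : (1 + k) * c * ((1 + k) * d) < a * b.
  by apply: ltr_pM => //; rewrite ltW // mulr_gt0.
rewrite mulrACA ltNge (le_trans bound) // ler_wpM2r ?(ltW (mulr_gt0 _ _)) //.
nra.
Qed.

(** This is the slow vector of the inverse isometry on the image of F under M, pulled back by M. *)
Lemma exists_fast_vector {m} (S : 'M[C]_m) : S \in unitmx ->
  exists2 K : R, 0 < K & forall (M : 'M[C]_m) p (F : 'M[C]_(p, m)),
    conjT M *m S *m M = S -> (m < \rank F + \rank F)%N ->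
    exists u : 'cV_m, [/\ (u^T <= F)%MS, u != 0 & normsq u <= K * normsq (M *m u)].
Proof.
move=> uS; have [K K0 HK] := exists_slow_vector S uS; exists K => // M p F hM hF.
have uM := sform_unit _ _ uS hM.
have uMT : row_free M^T by rewrite row_free_unit unitmx_tr.
have := HK _ _ (F *m M^T) (sform_inv _ _ uM hM).
rewrite mxrankMfree // => /(_ hF) [w [wF w0 hw]].
exists (invmx M *m w); split.
- have /submxP[D hx] := wF.
  by rewrite trmx_mul hx -!mulmxA -trmx_mul mulVmx // trmx1 mulmx1 submxMl.
- by apply: contraNneq w0 => h; rewrite -(mul1mx w) -(mulmxV uM) -mulmxA h mulmx0.
- by rewrite mulmxA mulmxV // mul1mx.
Qed.

End SquaredNorm.

(** * Limits of complex matrices along a filter *)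

Section ComplexLimits.
Local Open Scope classical_set_scope.
Context {R : realType}.
Local Notation C := R[i].

(** The filter is arbitrary in order to cover neighbourhoods of a point and ultrafilters on the
    integers alike. *)
Definition ccvg {T : Type} (F : set_system T) (f : T -> C) (l : C) : Prop :=
  ((fun t => complex.Re (f t)) @ F --> complex.Re l) /\
  ((fun t => complex.Im (f t)) @ F --> complex.Im l).

Definition mxcvg {T : Type} (F : set_system T) {m n} (M : T -> 'M[C]_(m, n))
  (L : 'M[C]_(m, n)) : Prop := forall i j, ccvg F (fun t => M t i j) (L i j).

Section Filter.
Context {T : Type} {F : set_system T} {FF : Filter F}.
Implicit Types (f g : T -> C) (a b : C).

Lemma ccvg_cst a : ccvg F (fun=> a) a.
Proof. by split; exact: cvg_cst. Qed.

Lemma ReD (x y : C) : complex.Re (x + y) = complex.Re x + complex.Re y.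
Proof. by case: x y => [? ?] [? ?]. Qed.

Lemma ImD (x y : C) : complex.Im (x + y) = complex.Im x + complex.Im y.
Proof. by case: x y => [? ?] [? ?]. Qed.

Lemma ReM (x y : C) : complex.Re (x * y) =
  complex.Re x * complex.Re y - complex.Im x * complex.Im y.
Proof. by case: x y => [? ?] [? ?]. Qed.

Lemma ImM (x y : C) : complex.Im (x * y) =
  complex.Re x * complex.Im y + complex.Im x * complex.Re y.
Proof. by case: x y => [? ?] [? ?]. Qed.

Lemma ccvgD f g a b : ccvg F f a -> ccvg F g b ->
  ccvg F (fun t => f t + g t) (a + b).
Proof.
move=> [fr fi] [gr gi]; split.
- by rewrite ReD; under eq_fun do rewrite ReD; exact: cvgD.
- by rewrite ImD; under eq_fun do rewrite ImD; exact: cvgD.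
Qed.

Lemma ccvgM f g a b : ccvg F f a -> ccvg F g b ->
  ccvg F (fun t => f t * g t) (a * b).
Proof.
move=> [fr fi] [gr gi]; split.
- rewrite ReM; under eq_fun do rewrite ReM.
  by apply: cvgB; apply: cvgM.
- rewrite ImM; under eq_fun do rewrite ImM.
  by apply: cvgD; apply: cvgM.
Qed.

Lemma ReJ (x : C) : complex.Re x^* = complex.Re x.
Proof. by case: x. Qed.

Lemma ImJ (x : C) : complex.Im x^* = - complex.Im x.
Proof. by case: x. Qed.

Lemma ccvg_real (f : T -> R) (a : R) : f @ F --> a -> ccvg F (fun t => (f t)%:C) a%:C.
Proof. by move=> fa; split => //=; exact: cvg_cst. Qed.

Lemma ccvg_sum {I : Type} (r : seq I) (P : pred I) (f : I -> T -> C) (a : I -> C) :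
  (forall i, ccvg F (f i) (a i)) ->
  ccvg F (fun t => \sum_(i <- r | P i) f i t) (\sum_(i <- r | P i) a i).
Proof.
move=> h; elim: r => [|i r IH].
  by under eq_fun do rewrite big_nil; rewrite big_nil; exact: ccvg_cst.
under eq_fun do rewrite big_cons; rewrite big_cons.
by case: (P i) => //; exact: ccvgD.
Qed.

Lemma ccvg_prod {I : Type} (r : seq I) (P : pred I) (f : I -> T -> C) (a : I -> C) :
  (forall i, ccvg F (f i) (a i)) ->
  ccvg F (fun t => \prod_(i <- r | P i) f i t) (\prod_(i <- r | P i) a i).
Proof.
move=> h; elim: r => [|i r IH].
  by under eq_fun do rewrite big_nil; rewrite big_nil; exact: ccvg_cst.
under eq_fun do rewrite big_cons; rewrite big_cons.
by case: (P i) => //; exact: ccvgM.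
Qed.

Lemma mxcvg_cst {m n} (M : 'M[C]_(m, n)) : mxcvg F (fun=> M) M.
Proof. by move=> i j; exact: ccvg_cst. Qed.

Lemma mxcvgM {m n p} (A : T -> 'M[C]_(m, n)) (B : T -> 'M[C]_(n, p)) A0 B0 :
  mxcvg F A A0 -> mxcvg F B B0 -> mxcvg F (fun t => A t *m B t) (A0 *m B0).
Proof.
move=> hA hB i j; rewrite mxE; under eq_fun do rewrite mxE.
by apply: ccvg_sum => k; exact: ccvgM.
Qed.

Lemma ccvg_det {n} (A : T -> 'M[C]_n) A0 :
  mxcvg F A A0 -> ccvg F (fun t => \det (A t)) (\det A0).
Proof.
move=> hA; rewrite /determinant.
apply: ccvg_sum => s; apply: ccvgM; first exact: ccvg_cst.
by apply: ccvg_prod => i; exact: hA.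
Qed.

Lemma cvg_sqc f a : ccvg F f a -> (fun t => sqc (f t)) @ F --> sqc a.
Proof. by move=> [fr fi]; rewrite /sqc; apply: cvgD; apply: cvgM. Qed.

Lemma cvg_normsq {m} (u : T -> 'cV[C]_m) u0 :
  mxcvg F u u0 -> (fun t => normsq (u t)) @ F --> normsq u0.
Proof.
move=> hu; rewrite normsqE; under eq_fun do rewrite normsqE.
suff h r : (fun t => \sum_(i <- r) sqc (u t i 0)) @ F -->
    \sum_(i <- r) sqc (u0 i 0) by exact: h.
elim: r => [|i r IH].
  rewrite big_nil (_ : (fun t : T => _) = fun=> 0); first exact: cvg_cst.
  by apply/funext => t; rewrite big_nil.
rewrite big_cons (_ : (fun t : T => _) =
  fun t => sqc (u t i 0) + \sum_(j <- r) sqc (u t j 0)).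
  by apply: cvgD; [apply: cvg_sqc; exact: hu | exact: IH].
by apply/funext => t; rewrite big_cons.
Qed.

Lemma ccvg_neq0 f a : ccvg F f a -> a != 0 -> \forall t \near F, f t != 0.
Proof.
move=> fa a0; have h := cvg_sqc _ _ fa.
have p : 0 < sqc a by rewrite lt_def sqc_ge0 sqc_eq0 a0.
near=> t; rewrite -sqc_eq0 gt_eqF //; near: t; exact: cvgr_gt h _ p.
Unshelve. all: by end_near.
Qed.

(** Lower semicontinuity of the rank: with one-sided inverses P and Q of the factors of a rank
    factorisation, P M0 Q is the identity, so the determinant of P M Q stays nonzero nearby. *)
Lemma rank_near_ge {m n} (M : T -> 'M[C]_(m, n)) M0 : mxcvg F M M0 ->
  \forall t \near F, (\rank M0 <= \rank (M t))%N.
Proof.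
move=> hM.
have /row_fullP[P hP] := col_base_full M0.
have /row_freeP[Q hQ] := row_base_free M0.
have h1 : P *m M0 *m Q = 1%:M.
  have := congr1 (fun X => P *m X *m Q) (mulmx_base M0).
  by rewrite /= mulmxA hP mul1mx hQ => <-.
have hdet : mxcvg F (fun t => P *m M t *m Q) (P *m M0 *m Q).
  by do 2?apply: mxcvgM => //; exact: mxcvg_cst.
have := ccvg_neq0 _ _ (ccvg_det _ _ hdet).
rewrite h1 det1 oner_eq0 => /(_ isT) hd; near=> t.
have dt : \det (P *m M t *m Q) != 0 by near: t.
have : P *m M t *m Q \in unitmx by rewrite unitmxE unitfE.
rewrite -row_free_unit -row_leq_rank => /leq_trans; apply.
by rewrite (leq_trans (mxrankM_maxl _ _)) // mxrankM_maxr.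
Unshelve. all: by end_near.
Qed.

End Filter.

Lemma ccontinuousP (f : R -> C) : ccontinuous f <-> forall x, ccvg (nbhs x) f (f x).
Proof. by split=> [[h1 h2] x|h]; [split; [exact: h1|exact: h2] | split=> x; case: (h x)]. Qed.

Lemma ccvg_comp {T : Type} {F : set_system T} {FF : Filter F} (x : T -> R) x0 (f : R -> C) :
  ccontinuous f -> x @ F --> x0 -> ccvg F (fun t => f (x t)) (f x0).
Proof.
move=> [h1 h2] hx; split.
- exact: (cvg_comp x (fun y => complex.Re (f y)) hx (h1 x0)).
- exact: (cvg_comp x (fun y => complex.Im (f y)) hx (h2 x0)).
Qed.

(** If u0 were outside the row space of B0, stacking it under B0 would raise the rank, hence also
    the rank of some B t stacked with u t, by lower semicontinuity. The constancy of the rank of B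
    prevents the limit space from shrinking. *)
Lemma in_sub_closed {T : Type} {F : set_system T} {FF : ProperFilter F} {m p}
    (B : T -> 'M[C]_m) B0 (u : T -> 'M[C]_(p, m)) u0 :
  mxcvg F B B0 -> mxcvg F u u0 ->
  (\forall t \near F, (u t <= B t)%MS /\ \rank (B t) = \rank B0) ->
  (u0 <= B0)%MS.
Proof.
move=> hB hu hs.
have hM : mxcvg F (fun t => col_mx (B t) (u t)) (col_mx B0 u0).
  move=> i j; rewrite mxE; under eq_fun do rewrite mxE.
  by case: (fintype.split i) => k.
have [t [[tu tB] trk]] := filter_ex (filterI hs (rank_near_ge _ _ hM)).
apply/negPn/negP => h.
have : (B0 < col_mx B0 u0)%MS.
  by rewrite ltmxE -!addsmxE addsmxSl addsmx_sub submx_refl.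
move/rank_ltmx; rewrite ltnNge (leq_trans trk) //.
by rewrite -tB mxrankS // -addsmxE addsmx_sub submx_refl.
Qed.

(** Ultrafilters replace the extraction of subsequences: a cluster point is a limit, so that several
    bounded sequences converge along one and the same filter. *)
Lemma ultra_bounded_cvg {T : Type} {F : set_system T} (a : T -> R) (b c : R) :
  UltraFilter F -> (forall t, b <= a t <= c) ->
  exists2 l, a @ F --> l & b <= l <= c.
Proof.
move=> FU hab.
have PF : ProperFilter (a @ F) := fmap_proper_filter a (@ultra_proper _ _ FU).
have FA : (a @ F) `[b, c] by apply: nearW => t; rewrite /= in_itv /=.
have [l [lbc hl]] := segment_compact PF FA.
exists l; last by move: lbc; rewrite /= in_itv.
move=> B hB; have [//|] := in_ultra_setVsetC (a @^-1` B) FU.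
move=> hC; have [] := hl (~` B) B hC hB.
by move=> x [].
Qed.

Lemma abs_le_of_sqr (x y c : R) : x ^+ 2 + y ^+ 2 <= c -> - (1 + c) <= x <= 1 + c.
Proof. by move=> hxy; apply/andP; split; nra. Qed.

Lemma ultra_ccvg {T : Type} {F : set_system T} (f : T -> C) (c : R) :
  UltraFilter F -> (forall t, sqc (f t) <= c) -> exists l, ccvg F f l.
Proof.
move=> FU hc.
have [t|lr hr _] := ultra_bounded_cvg (fun t => complex.Re (f t)) (- (1 + c)) (1 + c) FU.
  by apply: (abs_le_of_sqr _ (complex.Im (f t))); exact: hc.
have [t|li hi _] := ultra_bounded_cvg (fun t => complex.Im (f t)) (- (1 + c)) (1 + c) FU.
  by apply: (abs_le_of_sqr _ (complex.Re (f t))); rewrite addrC; exact: hc.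
by exists (Complex lr li).
Qed.

Lemma ultra_mxcvg {T : Type} {F : set_system T} {m} (u : T -> 'cV[C]_m) (c : R) :
  UltraFilter F -> (forall t, normsq (u t) <= c) -> exists l, mxcvg F u l.
Proof.
move=> FU hc.
have h i : exists l, ccvg F (fun t => u t i 0) l.
  by apply: (ultra_ccvg _ c) => // t; exact: le_trans (normsq_ge_coord _ _) (hc t).
pose l i := sval (cid (h i)).
exists (\col_i l i) => i j; rewrite mxE ord1; exact: (svalP (cid (h i))).
Qed.

End ComplexLimits.

(** * Uniformity of domination *)

Section Cocycles.
Local Open Scope classical_set_scope.
Context {R : realType}.
Local Notation C := R[i].

Definition mxcontinuous {m n} (A : R -> 'M[C]_(m, n)) : Prop :=
  forall i j, ccontinuous (fun x => A x i j).

Lemma mxcontinuousP {m n} (A : R -> 'M[C]_(m, n)) :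
  mxcontinuous A <-> forall x, mxcvg (nbhs x) A (A x).
Proof.
split=> [h x i j|h i j]; first by have /ccontinuousP := h i j; exact.
by apply/ccontinuousP => x; exact: h.
Qed.

Lemma periodic_int {T : Type} (f : R -> T) : (forall x, f (x + 1) = f x) ->
  forall (n : int) x, f (x + n%:~R) = f x.
Proof.
move=> hf; have hn (n : nat) x : f (x + n%:R) = f x.
  elim: n x => [|n IH] x; first by rewrite addr0.
  by rewrite -natr1 addrA hf.
case=> n x; first exact: hn.
by rewrite NegzE rmorphN /= -[in RHS](subrK n.+1%:R x) hn.
Qed.

Section Iteration.
Variables (alpha : R) (m : nat) (A : R -> 'M[C]_m).
Local Notation iter := (cocycle_iter alpha A).

Lemma cocycle_iterD j k x : iter (j + k)%N x = iter k (x + j%:R * alpha) *m iter j x.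
Proof.
elim: k => [|k IH]; first by rewrite addn0 mul1mx.
by rewrite addnS /= IH mulmxA natrD mulrDl addrA.
Qed.

Lemma cocycle_iter_periodic : (forall x, A (x + 1) = A x) ->
  forall n x, iter n (x + 1) = iter n x.
Proof. by move=> hA; elim=> [|n IH] x //=; rewrite IH addrAC hA. Qed.

Lemma cocycle_iter_continuous : mxcontinuous A -> forall n, mxcontinuous (iter n).
Proof.
move=> hA; elim=> [|n IH]; apply/mxcontinuousP => x; first exact: mxcvg_cst.
apply: mxcvgM; last by move/mxcontinuousP : IH; exact.
move=> i j.
apply: (ccvg_comp (fun y => y + n%:R * alpha) _ (fun y => A y i j)); first exact: hA.
by apply: cvgD; [exact: cvg_id | exact: cvg_cst].
Qed.

Lemma cocycle_iter_form (S : 'M[C]_m) : (forall x, conjT (A x) *m S *m A x = S) ->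
  forall n x, conjT (iter n x) *m S *m iter n x = S.
Proof.
move=> hA; elim=> [|n IH] x /=; first by rewrite /conjT map_mx1 trmx1 mul1mx mulmx1.
by rewrite conjTM -!mulmxA (mulmxA S) (mulmxA (conjT (A _))) (mulmxA (conjT (A _))) hA mulmxA.
Qed.

Lemma cocycle_iter_invariant (Ef : R -> 'M[C]_m) :
  (forall x, (Ef x *m (A x)^T == Ef (x + alpha)%R)%MS) ->
  forall n x, (Ef x *m (iter n x)^T == Ef (x + n%:R * alpha)%R)%MS.
Proof.
move=> hE; elim=> [|n IH] x /=; first by rewrite trmx1 mulmx1 mul0r addr0; apply/eqmxP.
rewrite trmx_mul mulmxA; apply/eqmxP.
apply: eqmx_trans (eqmxMr _ (eqmxP (IH x))) _.
apply: eqmx_trans (eqmxP (hE _)) _.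
by rewrite -addrA -natr1 mulrDl mul1r.
Qed.

End Iteration.

(** The total space of a continuous bundle is closed: [in_sub_closed] applies to a local frame at
    x0, whose rank is constant near x0. *)
Lemma subspace_continuous_limit {F : set_system nat} {FF : ProperFilter F} {m k}
    (Ef : R -> 'M[C]_m) (x : nat -> R) x0 (u : nat -> 'cV[C]_m) u0 :
  subspace_continuous Ef -> (forall y, \rank (Ef y) = k) ->
  x @ F --> x0 -> mxcvg F u u0 -> (forall n, in_sub (u n) (Ef (x n))) ->
  in_sub u0 (Ef x0).
Proof.
move=> /(_ x0)[delta [d0 [B [Bc Beq]]]] hk hx hu hin.
have B0 : (B x0 :=: Ef x0)%MS by apply/eqmxP; apply: Beq; rewrite subrr normr0.
rewrite /in_sub -B0.
apply: (in_sub_closed (F := F) (B \o x) (B x0) (fun n => (u n)^T)).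
- by move=> i j; apply: (ccvg_comp x _ (fun y => B y i j) _ hx); exact: Bc.
- by move=> i j; rewrite mxE; under eq_fun do rewrite mxE; exact: hu.
near=> n.
have Bn : (B (x n) :=: Ef (x n))%MS.
  by apply/eqmxP; apply: Beq; near: n; exact: cvgr_distC_lt.
by split; [rewrite /= Bn; exact: hin | rewrite /= Bn B0 !hk].
Unshelve. all: by end_near.
Qed.

(* Compactness: an ultrafilter limit of normalised counterexamples to
   rho = 1 - 1/n lies in the bundles, which are closed, and contradicts the
   strict inequality. *)
Lemma uniform_gap {m k k'} (B Ep Em : R -> 'M[C]_m) :
  mxcontinuous B -> (forall x, B (x + 1) = B x) ->
  (forall x, Ep (x + 1) = Ep x) -> (forall x, Em (x + 1) = Em x) ->
  subspace_continuous Ep -> subspace_continuous Em ->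
  (forall x, \rank (Ep x) = k) -> (forall x, \rank (Em x) = k') ->
  (forall x (u u' : 'cV[C]_m),
     in_sub u (Ep x) -> normsq u = 1 -> in_sub u' (Em x) -> normsq u' = 1 ->
     normsq (B x *m u') < normsq (B x *m u)) ->
  exists rho : R, [/\ 0 <= rho, rho < 1 &
    forall x u u', in_sub u (Ep x) -> in_sub u' (Em x) ->
      normsq (B x *m u') * normsq u <= rho * (normsq (B x *m u) * normsq u')].
Proof.
move=> Bc B1 Ep1 Em1 Epc Emc rEp rEm hlt.
suff [rho [r0 r1 hrho]] : exists rho : R, [/\ 0 <= rho, rho < 1 &
    forall x u u', 0 <= x <= 1 -> in_sub u (Ep x) -> normsq u = 1 ->
      in_sub u' (Em x) -> normsq u' = 1 ->
      normsq (B x *m u') <= rho * normsq (B x *m u)].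
  exists rho; split=> // x u u' hu hu'.
  have [->|u0] := eqVneq u 0; first by rewrite mulmx0 !normsq0 mul0r !mulr0.
  have [->|u'0] := eqVneq u' 0; first by rewrite mulmx0 !normsq0 mul0r !mulr0.
  (* Periodicity brings the phase into the compact interval [0, 1], and homogeneity reduces to unit
     vectors. *)
  pose y := x - (Num.floor x)%:~R.
  have yx (T : Type) (f : R -> T) : (forall z, f (z + 1) = f z) -> f y = f x.
    by move=> hf; rewrite -(periodic_int f hf (Num.floor x)) subrK.
  have y01 : 0 <= y <= 1.
    have /andP[h1 h2] := floor_itv x.
    rewrite subr_ge0 h1 /= lerBlDl (le_trans (ltW h2)) //.
    by rewrite rmorphD.
  have nu (w : 'cV[C]_m) (w0 : w != 0) c : c = (Num.sqrt (normsq w))^-1 ->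
      normsq (c%:C *: w) = 1.
    move=> ->; rewrite normsqZ /sqc /= expr0n addr0 exprVn sqr_sqrtr ?normsq_ge0 //.
    by rewrite mulVf // normsq_eq0.
  have sub (w : 'cV[C]_m) E c : in_sub w E -> in_sub (c *: w) E.
    by rewrite /in_sub linearZ /=; exact: scalemx_sub.
  have := hrho y _ _ y01 _ (nu u u0 _ erefl) _ (nu u' u'0 _ erefl).
  rewrite !yx // => /(_ (sub _ _ _ hu) (sub _ _ _ hu')).
  rewrite -!scalemxAr !normsqZ /sqc /= !expr0n !addr0 !exprVn !sqr_sqrtr ?normsq_ge0 //.
  rewrite ler_pdivrMl ?normsq_gt0 // => h.
  rewrite -ler_pdivlMr ?normsq_gt0 // (le_trans h) // le_eqVlt; apply/orP; left.
  by apply/eqP; ring.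
apply: contrapT => hno.
(* [harmonic n] is 1/(n+1): the candidate ratios increase from 0 to 1. *)
have hseq (n : nat) : exists z : R * ('cV[C]_m * 'cV[C]_m),
   [/\ 0 <= z.1 <= 1, in_sub z.2.1 (Ep z.1) /\ in_sub z.2.2 (Em z.1),
      normsq z.2.1 = 1, normsq z.2.2 = 1 &
      (1 - harmonic n) * normsq (B z.1 *m z.2.1) <= normsq (B z.1 *m z.2.2)].
  apply: contrapT => hn; apply: hno; exists (1 - harmonic n); split.
  - by rewrite subr_ge0 /harmonic invf_le1 ?ler1n.
  - by rewrite gtrBl harmonic_gt0.
  move=> x u u' hx hu nu hu' nu'; rewrite leNgt; apply/negP => h.
  by apply: hn; exists (x, (u, u')); split=> //; exact: ltW.
have [z hz] := choice hseq.
have [U [UU hU]] := ultraFilterLemma (@eventually_filter).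
have PU : ProperFilter U := @ultra_proper _ _ UU.
have [x hx _] := ultra_bounded_cvg (fun n => (z n).1) 0 1 UU
  (fun n => let: And5 h _ _ _ _ := hz n in h).
have [|u hu] := ultra_mxcvg (fun n => (z n).2.1) 1 UU.
  by move=> n; have [_ _ -> _ _] := hz n.
have [|u' hu'] := ultra_mxcvg (fun n => (z n).2.2) 1 UU.
  by move=> n; have [_ _ _ -> _] := hz n.
have inu : in_sub u (Ep x).
  apply: (subspace_continuous_limit _ _ _ _ _ Epc rEp hx hu) => n.
  by have [_ [] ] := hz n.
have inu' : in_sub u' (Em x).
  apply: (subspace_continuous_limit _ _ _ _ _ Emc rEm hx hu') => n.
  by have [_ [] ] := hz n.
have nu : normsq u = 1.
  apply: (cvg_unique _ (cvg_normsq _ _ hu)) => //.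
  rewrite (_ : (fun t => _) = fun=> 1); first exact: cvg_cst.
  by apply/funext => n; have [_ _ -> _ _] := hz n.
have nu' : normsq u' = 1.
  apply: (cvg_unique _ (cvg_normsq _ _ hu')) => //.
  rewrite (_ : (fun t => _) = fun=> 1); first exact: cvg_cst.
  by apply/funext => n; have [_ _ _ -> _] := hz n.
have := hlt x u u' inu nu inu' nu'; rewrite ltNge => /negP; apply.
have hB : mxcvg U (fun n => B (z n).1) (B x).
  by move=> i j; apply: (ccvg_comp _ _ (fun y => B y i j) _ hx); exact: Bc.
have c1 : (fun n => normsq (B (z n).1 *m (z n).2.1)) @ U --> normsq (B x *m u).
  by apply: cvg_normsq; exact: mxcvgM.
have c2 : (fun n => normsq (B (z n).1 *m (z n).2.2)) @ U --> normsq (B x *m u').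
  by apply: cvg_normsq; exact: mxcvgM.
have c3 : (fun n => 1 - @harmonic R n) @ U --> (1 : R).
  rewrite -[X in _ --> X]subr0; apply: cvgB; first exact: cvg_cst.
  by apply: cvg_trans cvg_harmonic; move=> V; exact: hU.
have := ler_cvg_to (cvgM c3 c1) c2; rewrite mul1r; apply.
by apply: nearW => n; have [_ _ _ _] := hz n.
Qed.

End Cocycles.

(** * Growth rates on dominated subspaces *)

Section Domination.
Local Open Scope classical_set_scope.
Context {R : realType}.
Local Notation C := R[i].

Lemma le_geometric_le0 (a K rho : R) (M : nat) : 0 <= rho -> rho < 1 ->
  (forall n, (M <= n)%N -> a <= K * rho ^+ n) -> a <= 0.
Proof.
move=> r0 r1 h.
have c : (fun n => K * rho ^+ n) @ \oo --> K * 0.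
  by apply: cvgM; [exact: cvg_cst | apply: cvg_expr; rewrite ger0_norm].
rewrite mulr0 in c; apply: (cvgr_to_ge c).
by near=> n; apply: h; near: n; exact: nbhs_infty_ge.
Unshelve. all: by end_near.
Qed.

Section Splitting.
Variables (alpha : R) (m : nat) (A : R -> 'M[C]_m) (S : 'M[C]_m).
Hypothesis uS : S \in unitmx.
Hypothesis AS : forall x, conjT (A x) *m S *m A x = S.
Hypothesis Ac : mxcontinuous A.
Hypothesis A1 : forall x, A (x + 1) = A x.
Local Notation iter := (cocycle_iter alpha A).

Lemma iter_unit n x : iter n x \in unitmx.
Proof. by apply: (sform_unit S) => //; exact: cocycle_iter_form. Qed.

Lemma iter_eq0 n x (u : 'cV[C]_m) : (iter n x *m u == 0) = (u == 0).
Proof.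
apply/eqP/eqP => [h|->]; last by rewrite mulmx0.
by rewrite -(mul1mx u) -(mulVmx (iter_unit n x)) -mulmxA h mulmx0.
Qed.

Lemma in_sub_iter (Ef : R -> 'M[C]_m) :
  (forall x, (Ef x *m (A x)^T == Ef (x + alpha)%R)%MS) ->
  forall n x u, in_sub u (Ef x) -> in_sub (iter n x *m u) (Ef (x + n%:R * alpha)).
Proof.
move=> /cocycle_iter_invariant hE n x u hu.
by rewrite /in_sub trmx_mul -(eqmxP (hE n x)) submxMr.
Qed.

Lemma in_sub_iter_preimage (Ef : R -> 'M[C]_m) :
  (forall x, (Ef x *m (A x)^T == Ef (x + alpha)%R)%MS) ->
  forall n x u, in_sub u (Ef (x + n%:R * alpha)) ->
  exists2 w, in_sub w (Ef x) & iter n x *m w = u.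
Proof.
move=> /cocycle_iter_invariant hE n x u.
rewrite /in_sub -(eqmxP (hE n x)) => /submxP[D hD].
exists (D *m Ef x)^T; first by rewrite /in_sub trmxK submxMl.
by apply: trmx_inj; rewrite trmx_mul trmxK hD mulmxA.
Qed.

(** The uniform ratio of [uniform_gap] is applied along the images of u and u', which stay in the
    invariant bundles, so the ratios multiply. Complementarity gives the rank of E^-. *)
Lemma dominated_rate k : dominated alpha A k ->
  exists (Ep Em : R -> 'M[C]_m) (N : nat) (rho : R),
  [/\ (forall x, \rank (Ep x) = k) /\ (forall x, \rank (Em x) = m - k)%N,
      (forall x, (Ep x *m (A x)^T == Ep (x + alpha)%R)%MS) /\
      (forall x, (Em x *m (A x)^T == Em (x + alpha)%R)%MS),
      (0 < N)%N, 0 <= rho < 1 &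
      forall n x u u', in_sub u (Ep x) -> in_sub u' (Em x) -> u != 0 ->
        normsq (iter (n * N) x *m u') * normsq u <=
        rho ^+ n * (normsq (iter (n * N) x *m u) * normsq u')].
Proof.
move=> [Ep [Em [per [Epc [Emc [hsum [rEp [inv [N [N0 hN]]]]]]]]]].
have rEm x : \rank (Em x) = (m - k)%N.
  have [/eqmxP h0 /eqmxP h1] := hsum x.
  have /mxrank_disjoint_sum : (Ep x :&: Em x)%MS = 0.
    by apply/eqP; rewrite -submx0 h0 sub0mx.
  by rewrite h1 mxrank1 rEp => e; apply/eqP; rewrite [X in (_ == X - _)%N]e addKn.
have invp x := (inv x).1; have invm x := (inv x).2.
have [rho [r0 r1 hrho]] := uniform_gap (iter N) Ep Em
  (cocycle_iter_continuous _ _ _ Ac N) (cocycle_iter_periodic _ _ _ A1 N)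
  (fun x => (per x).1) (fun x => (per x).2) Epc Emc rEp rEm hN.
exists Ep, Em, N, rho; split=> //; first by rewrite r0 r1.
move=> n x u u' hu hu' u0.
elim: n => [|n IH]; first by rewrite expr0 !mul1mx mul1r mulrC.
rewrite mulSnr cocycle_iterD -!mulmxA.
set w := iter (n * N) x *m u in IH *; set w' := iter (n * N) x *m u' in IH *.
have hw : in_sub w (Ep (x + (n * N)%:R * alpha)) by exact: in_sub_iter.
have hw' : in_sub w' (Em (x + (n * N)%:R * alpha)) by exact: in_sub_iter.
have := hrho _ _ _ hw hw'.
have w0 : 0 < normsq w by rewrite normsq_gt0 // iter_eq0.
have := normsq_ge0 (iter N (x + (n * N)%:R * alpha) *m w).
move: (normsq (_ *m w)) (normsq (_ *m w')) => p q p0 h.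
(* Both sides are multiplied by |w|^2, positive because the iterates are invertible, to bring in the
   ratio of a single block of N steps. *)
rewrite -(ler_pM2r w0) mulrAC (le_trans (ler_wpM2r (normsq_ge0 u) h)) //.
have := ler_wpM2l (mulr_ge0 r0 p0) IH.
by rewrite exprS; congr (_ <= _); ring.
Qed.

(** E^+ has more than half the dimension, so it contains a vector stretched by at most K, and
    domination against that vector contracts all of E^-. The vector depends on n and x, but K does
    not. *)
Lemma dominated_stable_decay k : (m < k + k)%N -> dominated alpha A k ->
  exists (Em : R -> 'M[C]_m) (N : nat) (K rho : R),
  [/\ forall x, \rank (Em x) = (m - k)%N,
      forall x, (Em x *m (A x)^T == Em (x + alpha)%R)%MS,
      (0 < N)%N, [/\ 0 < K, 0 <= rho & rho < 1] &
      forall n x u, in_sub u (Em x) ->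
        normsq (iter (n * N) x *m u) <= K * rho ^+ n * normsq u].
Proof.
move=> mk /dominated_rate[Ep [Em [N [rho [[rEp rEm] [ip im] N0 /andP[r0 r1] h]]]]].
have [K K0 HK] := exists_slow_vector S uS.
exists Em, N, K, rho; split=> // n x u hu.
have [|w [hw w0 Kw]] := HK (iter (n * N) x) _ (Ep x) (cocycle_iter_form _ _ _ _ AS _ _).
  by rewrite rEp.
rewrite -(ler_pM2r (normsq_gt0 _ w0)) (le_trans (h n x w u hw hu w0)) //.
have := ler_wpM2l (mulr_ge0 (exprn_ge0 n r0) (normsq_ge0 u)) Kw.
by congr (_ <= _); ring.
Qed.

(** Here E^- has more than half the dimension; comparison with a vector of E^- that is not
    contracted by more than K forces E^+ to expand. *)
Lemma dominated_unstable_growth k : (m < (m - k) + (m - k))%N -> dominated alpha A k ->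
  exists (Ep : R -> 'M[C]_m) (N : nat) (K rho : R),
  [/\ forall x, \rank (Ep x) = k,
      forall x, (Ep x *m (A x)^T == Ep (x + alpha)%R)%MS,
      (0 < N)%N, [/\ 0 < K, 0 <= rho & rho < 1] &
      forall n x u, in_sub u (Ep x) ->
        normsq u <= K * rho ^+ n * normsq (iter (n * N) x *m u)].
Proof.
move=> mk /dominated_rate[Ep [Em [N [rho [[rEp rEm] [ip im] N0 /andP[r0 r1] h]]]]].
have [K K0 HK] := exists_fast_vector S uS.
exists Ep, N, K, rho; split=> // n x u hu.
have [->|u0] := eqVneq u 0; first by rewrite mulmx0 normsq0 mulr0.
have [|w [hw w0 Kw]] := HK (iter (n * N) x) _ (Em x) (cocycle_iter_form _ _ _ _ AS _ _).
  by rewrite rEm.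
have Aw0 : 0 < normsq (iter (n * N) x *m w) by rewrite normsq_gt0 // iter_eq0.
rewrite -(ler_pM2l Aw0) (le_trans (h n x u w hu hw u0)) //.
have q0 := normsq_ge0 (iter (n * N) x *m u).
have := ler_wpM2l (mulr_ge0 (exprn_ge0 n r0) q0) Kw.
by congr (_ <= _); ring.
Qed.

End Splitting.
End Domination.

(** * Orbits vanishing at infinity *)

Section DecayingOrbits.
Local Open Scope classical_set_scope.
Context {R : realType}.
Local Notation C := R[i].
Variables (alpha : R) (m : nat) (A : R -> 'M[C]_m) (S : 'M[C]_m).
Local Notation iter := (cocycle_iter alpha A).

Definition is_orbit (U : int -> 'cV[C]_m) : Prop :=
  forall n : int, U (n + 1) = A (n%:~R * alpha) *m U n.

Definition vanishes_at_infinity (U : int -> 'cV[C]_m) : Prop :=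
  forall eps : R, 0 < eps ->
  exists M : nat, forall n : int, (M <= absz n)%N -> normsq (U n) <= eps.

Lemma orbit_iter U : is_orbit U ->
  forall (n : int) (k : nat), iter k (n%:~R * alpha) *m U n = U (n + k%:Z).
Proof.
move=> hU n; elim=> [|k IH]; first by rewrite mul1mx addr0.
rewrite /= -mulmxA IH -mulrDl.
have -> : n + k.+1%:Z = n + k%:Z + 1 by rewrite -addrA -PoszD addn1.
by rewrite hU rmorphD.
Qed.

Hypothesis uS : S \in unitmx.
Hypothesis AS : forall x, conjT (A x) *m S *m A x = S.

Lemma orbit_iter_at0 U k : is_orbit U -> iter k 0 *m U 0 = U k%:Z.
Proof. by move=> /orbit_iter/(_ 0 k); rewrite mul0r add0r. Qed.

Lemma orbit_iter_to0 U k : is_orbit U ->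
  iter k (- (k%:R * alpha)) *m U (- k%:Z) = U 0.
Proof. by move=> /orbit_iter/(_ (- k%:Z) k); rewrite rmorphN mulNr addNr. Qed.

Lemma sqc_le0 (z : C) : sqc z <= 0 -> z = 0.
Proof. by move=> h; apply/eqP; rewrite -sqc_eq0 eq_le h sqc_ge0. Qed.

(** The form takes the same value at time n N, where the orbit is bounded and the image of w is
    geometrically small. *)
Lemma sform_orbit_stable U (w : 'cV[C]_m) N K rho : is_orbit U ->
  vanishes_at_infinity U -> (0 < N)%N -> 0 <= rho -> rho < 1 ->
  (forall n, normsq (iter (n * N) 0 *m w) <= K * rho ^+ n * normsq w) ->
  sform S (U 0) w = 0.
Proof.
move=> hU vU N0 r0 r1 h; apply: sqc_le0.
have [K0 K00 HK0] := sform_bound S.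
have [M hM] := vU 1 ltr01.
apply: (le_geometric_le0 _ (K0 * (K * normsq w)) rho M) => // n Mn.
have hS := cocycle_iter_form alpha m A S AS (n * N) 0.
rewrite -(sform_mul _ _ _ _ hS) (le_trans (HK0 _ _)) // -!mulrA ler_pM2l //.
rewrite (mulrC (normsq w)) mulrA -[leRHS]mul1r ler_pM ?normsq_ge0 //.
rewrite orbit_iter_at0 // hM //= (leq_trans Mn) //.
by rewrite leq_pmulr.
Qed.

(** The same argument at time - n N: the preimage of w inside E^+ is geometrically small there,
    while the orbit is bounded. *)
Lemma sform_orbit_unstable U (Ep : R -> 'M[C]_m) (w : 'cV[C]_m) N K rho :
  is_orbit U -> vanishes_at_infinity U -> (0 < N)%N -> 0 <= rho -> rho < 1 ->
  (forall x, (Ep x *m (A x)^T == Ep (x + alpha)%R)%MS) -> in_sub w (Ep 0) ->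
  (forall n x u, in_sub u (Ep x) ->
        normsq u <= K * rho ^+ n * normsq (iter (n * N) x *m u)) ->
  sform S (U 0) w = 0.
Proof.
move=> hU vU N0 r0 r1 hE hw h; apply: sqc_le0.
have [K0 K00 HK0] := sform_bound S.
have [M hM] := vU 1 ltr01.
apply: (le_geometric_le0 _ (K0 * (K * normsq w)) rho M) => // n Mn.
have [|u hu uw] := in_sub_iter_preimage _ _ _ _ hE (n * N) (- ((n * N)%:R * alpha)) w.
  by rewrite addNr.
have hS := cocycle_iter_form alpha m A S AS (n * N) (- ((n * N)%:R * alpha)).
rewrite -(orbit_iter_to0 _ (n * N) hU) -{1}uw (sform_mul _ _ _ _ hS).
rewrite (le_trans (HK0 _ _)) // -!mulrA ler_pM2l //.
rewrite (mulrC (normsq w)) mulrA -[leRHS]mul1r ler_pM ?normsq_ge0 //.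
  by rewrite hM // abszN /= (leq_trans Mn) // leq_pmulr.
by rewrite -uw; exact: h.
Qed.

Lemma sform_orbits_vanishing U W : is_orbit U -> is_orbit W ->
  vanishes_at_infinity U -> vanishes_at_infinity W -> sform S (U 0) (W 0) = 0.
Proof.
move=> hU hW vU vW; apply: sqc_le0.
have [K0 K00 HK0] := sform_bound S.
apply/ler_addgt0Pl => e e0; rewrite addr0.
have [M hM] := vU (e / K0) (divr_gt0 e0 K00).
have [M' hM'] := vW 1 ltr01.
pose n := maxn M M'.
have hS := cocycle_iter_form alpha m A S AS n 0.
rewrite -(sform_mul _ _ _ _ hS) !orbit_iter_at0 // (le_trans (HK0 _ _)) //.
rewrite mulrC -ler_pdivlMr // -[leRHS]mulr1 ler_pM ?normsq_ge0 //.
  by rewrite hM //= leq_maxl.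
by rewrite hM' //= leq_maxr.
Qed.

Hypothesis Ac : mxcontinuous A.
Hypothesis A1 : forall x, A (x + 1) = A x.

Lemma no_vanishing_orbit_pair d (U : 'I_2 -> int -> 'cV[C]_m) : m = (d + d)%N ->
  dominated alpha A d.-1 -> dominated alpha A d.+1 ->
  (forall j, is_orbit (U j)) -> (forall j, vanishes_at_infinity (U j)) ->
  ~~ row_free (\matrix_j (U j 0)^T).
Proof.
move=> md dom1 dom2 hU vU.
(* For d = 0, domination at d + 1 would require a line in a space of dimension 0. *)
have d0 : (0 < d)%N.
  move: dom2 => [Ep [_ [_ [_ [_ [_ [rEp _]]]]]]].
  by have := rank_leq_row (Ep 0); rewrite rEp md; case: (d).
have dims : (d.-1 + (m - d.+1) = m - 2)%N by rewrite md; lia.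
have [|Em [N [K [rho [rEm im N0 [K0 r0 r1] hm]]]]] :=
  dominated_stable_decay _ _ _ _ uS AS Ac A1 d.+1 _ dom2.
  by rewrite md; lia.
have [|Ep [N' [K' [rho' [rEp ip N0' [K0' r0' r1'] hp]]]]] :=
  dominated_unstable_growth _ _ _ _ uS AS Ac A1 d.-1 _ dom1.
  by rewrite md; lia.
pose V := \matrix_j (U j 0)^T; apply/negP => freeV.
have rowV j : row j V = (U j 0)^T by rewrite rowK.
(* The rows of Y are the functionals [sform S (U j 0)], so [kermx Y^T] is the orthogonal of V. *)
pose Y := map_mx (@conjc R) V *m S.
have YE w j : (Y *m w) j 0 = sform S (U j 0) w.
  rewrite /sform mxE [RHS]mxE; apply: eq_bigr => i _; congr (_ * _).
  by rewrite !mxE; apply: eq_bigr => k _; rewrite !mxE.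
have rY : \rank Y = 2.
  by rewrite mxrankMfree ?row_free_unit // mxrank_map (eqP freeV).
have kerP (w : 'cV_m) : (forall j, sform S (U j 0) w = 0) -> (w^T <= kermx Y^T)%MS.
  move=> hw; apply/sub_kermxP; rewrite -trmx_mul; apply/trmx_inj/colP => j.
  by rewrite trmxK YE hw !mxE.
have Epker : (Ep 0 <= kermx Y^T)%MS.
  apply/row_subP => i; rewrite -[row i _]trmxK; apply: kerP => j.
  apply: (sform_orbit_unstable _ _ _ _ _ _ (hU j) (vU j) N0' r0' r1' ip _ hp).
  by rewrite /in_sub trmxK row_sub.
have Emker : (Em 0 <= kermx Y^T)%MS.
  apply/row_subP => i; rewrite -[row i _]trmxK; apply: kerP => j.
  apply: (sform_orbit_stable _ _ _ _ _ (hU j) (vU j) N0 r0 r1) => n.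
  by apply: hm; rewrite /in_sub trmxK row_sub.
(* A common vector has at time n N N', a multiple of both block lengths, a norm that is bounded by
   contraction and large by expansion. *)
have cap0 : (Ep 0 :&: Em 0 = 0)%MS.
  apply/eqP; apply/rowV0P => z; rewrite sub_capmx => /andP[zp zm].
  apply: trmx_inj; rewrite trmx0; apply/eqP; rewrite -normsq_eq0 eq_le normsq_ge0 andbT.
  have zp' : in_sub z^T (Ep 0) by rewrite /in_sub trmxK.
  have zm' : in_sub z^T (Em 0) by rewrite /in_sub trmxK.
  apply: (le_geometric_le0 _ (K' * (K * normsq z^T)) rho' 0) => // n _.
  have hp' := hp (n * N)%N 0 _ zp'.
  have hm' := hm (n * N')%N 0 _ zm'.
  apply: (le_trans hp').
  have -> : (n * N * N')%N = (n * N' * N)%N by rewrite mulnAC.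
  have r1n k : rho ^+ k <= 1 by rewrite exprn_ile1 // ltW.
  have r1n' : rho' ^+ (n * N) <= rho' ^+ n.
    by rewrite ler_wiXn2l // ?ltW // leq_pmulr.
  apply: (@le_trans _ _ (K' * rho' ^+ (n * N) * (K * normsq z^T))).
    apply: ler_wpM2l; first by rewrite mulr_ge0 ?exprn_ge0 // ltW.
    rewrite (le_trans hm') //.
    by rewrite ler_wpM2r ?normsq_ge0 // ler_piMr // ltW.
  by rewrite mulrAC ler_wpM2l // !mulr_ge0 ?normsq_ge0 // ltW.
have kersub : (kermx Y^T <= Ep 0 + Em 0)%MS.
  have hsub : (Ep 0 + Em 0 <= kermx Y^T)%MS by rewrite addsmx_sub Epker.
  rewrite -(mxrank_leqif_sup hsub) mxrank_disjoint_sum // rEp rEm.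
  by rewrite mxrank_ker mxrank_tr rY dims.
have Uj0 j : U j 0 = 0.
  have : ((U j 0)^T <= Ep 0 + Em 0)%MS.
    apply: submx_trans kersub; apply: kerP => i.
    exact: sform_orbits_vanishing.
  case/sub_addsmxP => -[D D'] /= hD.
  pose a := (D *m Ep 0)^T; pose b := (D' *m Em 0)^T.
  have Uab : U j 0 = a + b by apply: trmx_inj; rewrite hD linearD /= !trmxK.
  have ha : in_sub a (Ep 0) by rewrite /in_sub trmxK submxMl.
  have hb : in_sub b (Em 0) by rewrite /in_sub trmxK submxMl.
  have [M hM] := vU j 1 ltr01.
  have a0 : a = 0.
    apply/eqP; rewrite -normsq_eq0 eq_le normsq_ge0 andbT.
    (* The forward orbit of a is the difference of those of U j 0 and b, hence bounded: 1 bounds the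
       orbit, [K * normsq b] bounds the part in E^-, and 2 comes from [normsqD]. *)
    pose K2 := K' * (2 * (1 + K * normsq b)).
    apply: (le_geometric_le0 _ K2 rho' M) => // n Mn.
    apply: (le_trans (hp (n * N)%N 0 _ ha)).
    have r1n k : rho ^+ k <= 1 by rewrite exprn_ile1 // ltW.
    have r1n' : rho' ^+ (n * N) <= rho' ^+ n.
      by rewrite ler_wiXn2l // ?ltW // leq_pmulr.
    have hm' := hm (n * N')%N 0 _ hb.
    have -> : (n * N * N')%N = (n * N' * N)%N by rewrite mulnAC.
    have bnd : normsq (iter (n * N' * N) 0 *m a) <= 2 * (1 + K * normsq b).
      rewrite (_ : a = U j 0 + (-1) *: b); last by rewrite Uab scaleN1r addrK.
      rewrite mulmxDr (le_trans (normsqD _ _)) // ler_pM2l // lerD //.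
        rewrite orbit_iter_at0 // hM //= (leq_trans Mn) //.
        by rewrite -mulnA leq_pmulr // muln_gt0 N0 N0'.
      rewrite -scalemxAr normsqZ /sqc /= sqrrN expr1n oppr0 expr0n addr0 mul1r.
      rewrite (le_trans hm') // ler_wpM2r ?normsq_ge0 //.
      by rewrite ler_piMr // ltW.
    rewrite /K2 (le_trans (ler_wpM2l _ bnd)) //.
      by rewrite mulr_ge0 ?exprn_ge0 // ltW.
    rewrite mulrAC ler_wpM2l // mulr_ge0 //; first exact: ltW.
    by rewrite mulr_ge0 // addr_ge0 // mulr_ge0 ?normsq_ge0 // ltW.
  rewrite a0 add0r in Uab; apply/eqP; rewrite -normsq_eq0 eq_le normsq_ge0 andbT.
  apply: (le_geometric_le0 _ K rho M) => // n Mn.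
  (* Only b in E^- remains. Its preimage at time - n N is the orbit itself, by invertibility, hence
     bounded, and contraction back to time 0 makes b vanish. *)
  have [|u hu ub] := in_sub_iter_preimage _ _ _ _ im (n * N) (- ((n * N)%:R * alpha)) b.
    by rewrite addNr.
  have uE : u = U j (- (n * N)%:Z).
    apply/eqP; rewrite -subr_eq0.
    rewrite -(iter_eq0 alpha m A S uS AS (n * N) (- ((n * N)%:R * alpha))).
    by rewrite mulmxBr ub (orbit_iter_to0 _ _ (hU j)) Uab subrr.
  rewrite Uab -ub (le_trans (hm _ _ _ hu)) //.
  rewrite -[leRHS]mulr1 ler_wpM2l //.
    by rewrite mulr_ge0 ?exprn_ge0 // ltW.
  by rewrite uE hM // abszN /= (leq_trans Mn) // leq_pmulr.
have V0 : V = 0 by apply/row_matrixP => j; rewrite rowV Uj0 trmx0 row0.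
by move: freeV; rewrite -/V V0 /row_free mxrank0.
Qed.

End DecayingOrbits.

(** * The form preserved by the transfer matrix *)

Section SymplecticTransfer.
Context {R : realType}.
Local Notation C := R[i].
Variables (d : nat) (vh : int -> C).
Hypothesis vd0 : vh d%:Z != 0.
Hypothesis vherm : forall k : int, (absz k <= d)%N -> vh (- k) = conjc (vh k).

(** [Cmat] is triangular with [vh d] on its diagonal, and T is the explicit inverse of the block
    antidiagonal matrix. *)
Lemma Smat_unit : Smat d vh \in unitmx.
Proof.
have uC : Cmat d vh \in unitmx.
  rewrite -unitmx_tr unitmxE det_trig.
    rewrite unitfE; apply/prodf_neq0 => i _; rewrite !mxE leqnn.
    by rewrite addrNK.
  by apply/is_trig_mxP => i j ij; rewrite !mxE leqNgt ij.
have uC' : conjT (Cmat d vh) \in unitmx by rewrite conjT_unit.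
pose T := block_mx 0 (invmx (Cmat d vh)) (- invmx (conjT (Cmat d vh))) 0.
suff /mulmx1_unit[] : Smat d vh *m T = 1%:M by [].
rewrite mulmx_block !mulmx0 !mul0mx !add0r !addr0 mulmxN mulNmx opprK.
by rewrite !mulmxV // -scalar_mx_block.
Qed.

(* Entries of Smat indexed by nat; the kernel vanishes at index d + d, so that
   the shift of indices performed by the transfer matrix needs no boundary case. *)
Definition Skernel (i j : nat) : C :=
  if [&& d <= i, j < d & i <= j + d]%N then vh (i%:Z - j%:Z)
  else if [&& i < d, d <= j & j <= i + d]%N then - vh (i%:Z - j%:Z) else 0.

(** Hermitian symmetry writes the entries of - C^* as - vh (i - j), so that both blocks become
    functions of i - j. *)
Lemma SmatE (i j : 'I_(d + d)) : Smat d vh i j = Skernel i j.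
Proof.
rewrite /Smat /block_mx mxE /Skernel.
case: (splitP i) => i' ->; rewrite mxE; case: (splitP j) => j' ->.
- rewrite mxE; have hi := ltn_ord i'; have hj := ltn_ord j'.
  by do ![case: ifP => [|_]; first lia].
- have hi := ltn_ord i'; have hj := ltn_ord j'; rewrite !mxE.
  have [h|h] := leqP j' i'.
    case: ifP => [|_]; first lia.
    case: ifP => [_|]; last lia.
    by rewrite -vherm; [congr (- vh _); lia | lia].
  rewrite rmorph0 oppr0.
  by do ![case: ifP => [|_]; first lia].
- have hi := ltn_ord i'; have hj := ltn_ord j'; rewrite !mxE.
  have [h|h] := leqP i' j'.
    case: ifP => [_|]; last lia.
    by congr (vh _); lia.
  by do ![case: ifP => [|_]; first lia].
- rewrite mxE; have hi := ltn_ord i'; have hj := ltn_ord j'.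
  by do ![case: ifP => [|_]; first lia].
Qed.

Lemma sum_delta n k (F : nat -> C) :
  \sum_(a < n) ((a : nat) == k)%:R * F a = if (k < n)%N then F k else 0.
Proof.
case: ifP => kn.
  rewrite (bigD1 (Ordinal kn)) //= eqxx mul1r big1 ?addr0 // => a ak.
  by rewrite (_ : (_ == _) = false) ?mul0r //; apply: negbTE.
rewrite big1 // => a _; rewrite (_ : (_ == _) = false) ?mul0r //.
by apply/negbTE; apply: contraFneq kn => <-.
Qed.

Section Product.
Variables (q E : R).

Definition transfer_row (j : nat) : C :=
  (let k := (d%:Z - 1 - j%:Z)%R in
   (if k == 0 then E%:C - q%:C - vh 0 else - vh k) / vh d%:Z).

Lemma transferE (i j : 'I_(d + d)) : transfer d vh q%:C E i j =
  ((i : nat) == 0%N)%:R * transfer_row j + ((i : nat) == j.+1)%:R.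
Proof.
rewrite mxE; case: i => [[|i] hi] /=; first by rewrite mul1r addr0.
by rewrite mul0r add0r eqSS eq_sym.
Qed.

(** Column j has contributions only from row 0 and row j + 1; the hypothesis on F covers the last
    column, where row j + 1 does not exist. *)
Lemma sum_transfer (j : 'I_(d + d)) (F : nat -> C) : F (d + d)%N = 0 ->
  \sum_(a < d + d) F a * transfer d vh q%:C E a j = F 0%N * transfer_row j + F j.+1.
Proof.
move=> F0; under eq_bigr do rewrite transferE mulrDr.
rewrite big_split /=; congr (_ + _).
  under eq_bigr do rewrite mulrCA.
  rewrite (sum_delta _ 0 (fun a => F a * transfer_row j)).
  by rewrite (leq_ltn_trans _ (ltn_ord j)).
under eq_bigr do rewrite mulrC; rewrite sum_delta.
case: ltnP => // h; rewrite (_ : j.+1 = d + d)%N ?F0 //.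
by apply/eqP; rewrite eqn_leq h andbT.
Qed.

(** Two uses of [sum_transfer] leave four terms. Shifting both indices by one preserves [Skernel]
    unless i + 1 = d or j + 1 = d; there the first row, with its denominator cleared by the entry
    [vh d] of the form, compensates the change. When both equalities hold, the terms cancel because
    E - q - vh 0 is real. *)
Lemma transfer_form :
  conjT (transfer d vh q%:C E) *m Smat d vh *m transfer d vh q%:C E = Smat d vh.
Proof.
apply/matrixP => i j; rewrite SmatE mxE.
have d0 : (0 < d)%N by case: (d) i => [[]|].
have h1 b : (conjT (transfer d vh q%:C E) *m Smat d vh) i b =
    conjc (transfer_row i) * Skernel 0 b + Skernel i.+1 b.
  rewrite mxE; under eq_bigr do rewrite conjT_mxE SmatE.
  (* Conjugating the sum lets [sum_transfer] act on the left factor too. *)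
  rewrite -[LHS]conjcK rmorph_sum.
  under eq_bigr do rewrite rmorphM /= conjcK mulrC.
  rewrite (sum_transfer i (fun a => conjc (Skernel a b))).
    by rewrite rmorphD rmorphM /= !conjcK mulrC.
  rewrite /Skernel; case: ifP => [|_]; first by have := ltn_ord b; lia.
  by case: ifP => [|_]; [lia | rewrite rmorph0].
under eq_bigr do rewrite h1.
rewrite (sum_transfer j
  (fun b => conjc (transfer_row i) * Skernel 0 b + Skernel i.+1 b)); last first.
  rewrite /Skernel; have := ltn_ord i => hi.
  by do ![case: ifP => [|_]; first lia]; rewrite mulr0 addr0.
have S00 : Skernel 0 0 = 0.
  by rewrite /Skernel; do ![case: ifP => [|_]; first lia].
have Sk0 : Skernel i.+1 0 = (i.+1 == d)%:R * vh d%:Z.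
  rewrite /Skernel; case: (eqVneq i.+1 d) => [->|ne].
    by rewrite leqnn d0 /= ?add0n ?leqnn /= ?subr0 mul1r.
  by do ![case: ifP => [|_]; first lia]; rewrite mul0r.
have S0k : Skernel 0 j.+1 = - ((j.+1 == d)%:R * conjc (vh d%:Z)).
  rewrite /Skernel; case: (eqVneq j.+1 d) => [->|ne].
    by rewrite leqn0 (gtn_eqF d0) /= d0 leqnn ?add0n ?leqnn /= sub0r mul1r vherm.
  by do ![case: ifP => [|_]; first lia]; rewrite mul0r oppr0.
rewrite S00 mulr0 add0r Sk0 S0k.
(* [rho] is [transfer_row] multiplied by [vh d]. *)
pose rho (k : nat) := if k.+1 == d then E%:C - q%:C - vh 0 else - vh (d%:Z - 1 - k%:Z).
have rhoE k : transfer_row k * vh d%:Z = rho k.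
  rewrite /transfer_row mulfVK // /rho; case: ifP => h1'; case: ifP => h2' //; lia.
have rhoE' k : conjc (transfer_row k) * conjc (vh d%:Z) = conjc (rho k).
  by rewrite -rhoE; apply/esym; exact: rmorphM.
have -> : (i.+1 == d)%:R * vh d%:Z * transfer_row j = (i.+1 == d)%:R * rho j.
  by rewrite -rhoE mulrAC mulrA.
have -> : conjc (transfer_row i) * - ((j.+1 == d)%:R * conjc (vh d%:Z)) =
   - ((j.+1 == d)%:R * conjc (rho i)).
  by rewrite -rhoE' mulrN mulrCA.
have v0 : conjc (vh 0) = vh 0 by rewrite -vherm // oppr0.
have hi := ltn_ord i; have hj := ltn_ord j.
have Sij : (i.+1 != d) -> (j.+1 != d) -> Skernel i.+1 j.+1 = Skernel i j.
  move=> hi' hj'; rewrite /Skernel (_ : i.+1%:Z - j.+1%:Z = i%:Z - j%:Z); last by lia.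
  by do ![case: ifP => ?]; try lia.
rewrite /rho; case: (eqVneq i.+1 d) => hid; case: (eqVneq j.+1 d) => hjd.
- have -> : conjc (E%:C - q%:C - vh 0) = E%:C - q%:C - vh 0.
    move: v0; case: (vh 0) => a b [hb].
    by apply/eqP; rewrite eq_complex /= eqxx; apply/eqP; lra.
  rewrite !mul1r /Skernel.
  do ![case: ifP => [|_]; first lia].
  by rewrite addr0; exact: subrr.
- rewrite mul1r mul0r oppr0 add0r; have [jd|jd] := ltnP j d.
    rewrite /Skernel; case: ifP => [_|]; last lia.
    do ![case: ifP => [|_]; first lia].
    by rewrite addrC (_ : i.+1%:Z - j.+1%:Z = d%:Z - 1 - j%:Z) ?subrr //; lia.
  rewrite /Skernel; do ![case: ifP => [|_]; first lia].
  case: ifP => [_|]; last lia.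
  by rewrite addr0; congr (- vh _); lia.
- rewrite mul0r mul1r add0r (raddfN (@conjc R)) /= opprK -vherm; last lia.
  have [id|id] := ltnP i d.
    rewrite /Skernel; case: ifP => [|_]; first lia.
    case: ifP => [_|]; last lia.
    do ![case: ifP => [|_]; first lia].
    by rewrite (_ : i.+1%:Z - j.+1%:Z = - (d%:Z - 1 - i%:Z)) ?subrr //; lia.
  rewrite /Skernel; do ![case: ifP => [|_]; first lia].
  case: ifP => [_|]; last lia.
  by rewrite addr0; congr (vh _); lia.
- by rewrite !mul0r oppr0 !add0r Sij.
Qed.

End Product.
End SymplecticTransfer.

(** * Primitives of continuous functions *)

Section MeanValue.
Local Open Scope classical_set_scope.
Context {R : realType}.
Implicit Types f g F G : R -> R.

Definition is_primitive f F : Prop := forall x : R, is_derive x (1 : R) F (f x).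

Lemma is_derive_0_cst_gt f (a x y : R) :
  (forall z, a < z -> is_derive z (1 : R) f 0) -> a < x -> a < y -> f x = f y.
Proof.
wlog xy : x y / x <= y => [H h ax ay|h ax ay].
  by have [xy|/ltW xy] := lerP x y; [exact: H | apply/esym; exact: H].
have ha z : z \in `[x, y]%R -> is_derive z (1 : R) f 0.
  by rewrite in_itv /= => /andP[xz _]; exact: h (lt_le_trans ax xz).
have h1 z : z \in `]x, y[%R -> is_derive z (1 : R) f 0.
  by move=> zxy; apply: ha; exact: subset_itv_oo_cc zxy.
have h2 : {within `[x, y], continuous f}.
  by apply: derivable_within_continuous => z /ha[].
have [c _] := MVT_segment xy h1 h2.
by rewrite mul0r => /eqP; rewrite subr_eq0 => /eqP ->.
Qed.

Lemma primitive_gt f (a : R) : continuous f ->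
  exists F, forall x, a < x -> is_derive x (1 : R) F (f x).
Proof.
move=> fc; exists (fun x => (\int[lebesgue_measure]_(t in `[a, x]) f t)%R) => x ax.
have xx : x < x + 1 by rewrite ltrDl.
have fi : lebesgue_measure.-integrable `[a, x + 1] (EFin \o f).
  apply: continuous_compact_integrable; first exact: segment_compact.
  exact: continuous_subspaceT.
have [d1 d2] := continuous_FTC1_closed xx fi ax (fc x).
by apply: DeriveDef; [exact: d1 | rewrite -derive1E; exact: d2].
Qed.

(** The integral from -n is a primitive only to the right of -n. Normalised at 0, these primitives
    agree on common domains, so choosing n beyond |x| glues them over the whole line. *)
Lemma primitive_exists f : continuous f -> exists F, is_primitive f F.
Proof.
move=> fc; have h (n : nat) := primitive_gt f (- n%:R) fc.
have [G hG] := choice h.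
pose N (x : R) := (Num.truncn `|x|).+1.
have xN x : `|x| < (N x)%:R by exact: truncnS_gt.
have GG n m x : (0 < n)%N -> (n <= m)%N -> `|x| < n%:R ->
    G m x - G m 0 = G n x - G n 0.
  move=> n0 nm xn.
  have hd (z : R) : - n%:R < z -> is_derive z (1 : R) (G m \- G n) 0.
    move=> nz; rewrite -(subrr (f z)); apply: is_deriveB; apply: hG => //.
    by rewrite (le_lt_trans _ nz) // lerN2 ler_nat.
  have nx : - n%:R < x by move: xn; rewrite ltr_norml => /andP[].
  have n0' : - n%:R < 0 :> R by rewrite ltrNl oppr0 ltr0n.
  by have /= := is_derive_0_cst_gt _ _ _ _ hd nx n0' => ?; lra.
exists (fun x => G (N x) x - G (N x) 0) => x.
(* The extra unit keeps every y at distance less than 1 from x in the domain |y| < n. *)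
pose n := (N x).+1.
have xn : `|x| < n%:R by rewrite (lt_trans (xN x)) // ltr_nat.
have dn : is_derive x (1 : R) (fun y => G n y - G n 0) (f x).
  rewrite -[f x]subr0; apply: is_deriveB; apply: hG.
  by move: xn; rewrite ltr_norml => /andP[].
apply: near_eq_is_derive dn; near=> y.
have yn : `|y| < n%:R.
  have yx : `|y - x| < 1 by near: y; apply: cvgr_distC_lt; [exact: cvg_id|].
  rewrite -(subrK x y) (le_lt_trans (ler_normD _ _)) // /n -natr1 addrC.
  exact: ltrD.
have [le|/ltnW le] := leqP (N y) n; first exact: GG.
by apply/esym; apply: GG.
Unshelve. all: by end_near.
Qed.

End MeanValue.

(** * Means of periodic functions *)

Section Means.
Local Open Scope classical_set_scope.
Context {R : realType}.
Local Notation C := R[i].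
Implicit Types f g F G : R -> R.

(* The mean over [0, 1], with junk value 0 when f has no primitive. *)
Definition mean f : R :=
  xget 0 [set c | exists2 F, is_primitive f F & c = F 1 - F 0].

Lemma meanE f F : is_primitive f F -> mean f = F 1 - F 0.
Proof.
move=> hF; apply: xget_unique; first by exists F.
move=> y [G hG ->].
have h (x : R) : is_derive x (1 : R) (G \- F) 0.
  by rewrite -(subrr (f x)); exact: is_deriveB.
by have /= := is_derive_0_is_cst 1 0 h => ?; lra.
Qed.

Lemma primitive_increment f F (a b : R) : is_primitive f F -> a <= b ->
  exists2 c, a <= c <= b & F b - F a = f c * (b - a).
Proof.
move=> hF ab.
have h1 z : z \in `]a, b[%R -> is_derive z (1 : R) F (f z) by move=> _; exact: hF.
have h2 : {within `[a, b], continuous F}.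
  by apply: derivable_within_continuous => z _; case: (hF z).
have [c cab e] := MVT_segment ab h1 h2.
by exists c => //; move: cab; rewrite in_itv.
Qed.

Lemma mean_value f : continuous f -> exists2 c, 0 <= c <= 1 & mean f = f c.
Proof.
move=> /primitive_exists[F hF]; rewrite (meanE _ _ hF).
have [c c01 ->] := primitive_increment _ _ _ _ hF (@ler01 R).
by exists c => //; rewrite subr0 mulr1.
Qed.

Lemma meanD f g : continuous f -> continuous g ->
  mean (fun x => f x + g x) = mean f + mean g.
Proof.
move=> /primitive_exists[F hF] /primitive_exists[G hG].
rewrite (meanE _ _ hF) (meanE _ _ hG) (meanE _ (F \+ G)); first by rewrite /=; ring.
by move=> x; exact: is_deriveD.
Qed.

Lemma meanZ (c : R) f : continuous f -> mean (fun x => c * f x) = c * mean f.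
Proof.
move=> /primitive_exists[F hF].
rewrite (meanE _ _ hF) (meanE _ (c \*: F)); first by rewrite /= /GRing.scale /=; ring.
by move=> x; exact: is_deriveZ.
Qed.

Lemma is_derive_shiftr F (a x d : R) : is_derive (x + a) (1 : R) F d ->
  is_derive x (1 : R) (fun y => F (y + a)) d.
Proof.
move=> h; rewrite -[d]mulr1.
by apply: (@is_derive1_comp _ F (shift a)); exact: is_derive_shift.
Qed.

(** The increment of a primitive over one period has derivative f (x + 1) - f x = 0, so it does not
    depend on its starting point. *)
Lemma mean_shift f (a : R) : continuous f -> (forall x, f (x + 1) = f x) ->
  mean (fun x => f (x + a)) = mean f.
Proof.
move=> /primitive_exists[F hF] f1.
rewrite (meanE _ _ hF) (meanE _ (fun x => F (x + a))); last first.
  by move=> x; exact: is_derive_shiftr.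
pose D (x : R) := F (x + 1) - F x.
have h (x : R) : is_derive x (1 : R) D 0.
  rewrite -(subrr (f x)); apply: is_deriveB; last exact: hF.
  by apply: is_derive_shiftr; rewrite -f1; exact: hF.
by have := is_derive_0_is_cst a 0 h; rewrite /D !add0r (addrC 1).
Qed.

(** * Continuity and means of complex-valued functions *)

Lemma ccontinuousD (f g : R -> C) : ccontinuous f -> ccontinuous g ->
  ccontinuous (fun x => f x + g x).
Proof.
by move=> /ccontinuousP hf /ccontinuousP hg; apply/ccontinuousP => x; exact: ccvgD.
Qed.

Lemma ccontinuousM (f g : R -> C) : ccontinuous f -> ccontinuous g ->
  ccontinuous (fun x => f x * g x).
Proof.
by move=> /ccontinuousP hf /ccontinuousP hg; apply/ccontinuousP => x; exact: ccvgM.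
Qed.

Lemma ccontinuous_cst (c : C) : ccontinuous (fun=> c).
Proof. by apply/ccontinuousP => x; exact: ccvg_cst. Qed.

Lemma ccontinuous_sum {I : Type} (r : seq I) (f : I -> R -> C) :
  (forall i, ccontinuous (f i)) -> ccontinuous (fun x => \sum_(i <- r) f i x).
Proof.
by move=> h; apply/ccontinuousP => x; apply: ccvg_sum => i; have /ccontinuousP := h i.
Qed.

Lemma ccontinuous_real f : continuous f -> ccontinuous (fun x => (f x)%:C).
Proof. by move=> h; apply/ccontinuousP => x; apply: ccvg_real; exact: h. Qed.

Lemma continuous_shiftr f (a : R) : continuous f -> continuous (fun x => f (x + a)).
Proof.
move=> h x; apply: (cvg_comp (fun y : R => y + a) f _ (h (x + a))).
by apply: cvgD; [exact: cvg_id | exact: cvg_cst].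
Qed.

Lemma ccontinuous_shiftr (f : R -> C) (a : R) :
  ccontinuous f -> ccontinuous (fun x => f (x + a)).
Proof.
by move=> [h1 h2]; split; [exact: (continuous_shiftr (fun x => complex.Re (f x)))
  | exact: (continuous_shiftr (fun x => complex.Im (f x)))].
Qed.

Definition cmean (f : R -> C) : C :=
  Complex (mean (fun x => complex.Re (f x))) (mean (fun x => complex.Im (f x))).

Lemma cmeanD (f g : R -> C) : ccontinuous f -> ccontinuous g ->
  cmean (fun x => f x + g x) = cmean f + cmean g.
Proof.
move=> [fr fi] [gr gi]; rewrite /cmean.
under eq_fun do rewrite ReD; under [X in Complex _ (mean X)]eq_fun do rewrite ImD.
by rewrite !meanD.
Qed.

Lemma cmeanZ (c : C) (f : R -> C) : ccontinuous f ->
  cmean (fun x => c * f x) = c * cmean f.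
Proof.
move=> [fr fi]; rewrite /cmean.
have cr (a : R) g : continuous g -> continuous (fun x => a * g x).
  by move=> gc x; apply: cvgM; [exact: cvg_cst | exact: gc].
have -> : (fun x => complex.Re (c * f x)) =
    fun x => complex.Re c * complex.Re (f x) + - complex.Im c * complex.Im (f x).
  by apply/funext => x; rewrite ReM mulNr.
have -> : (fun x => complex.Im (c * f x)) =
    fun x => complex.Re c * complex.Im (f x) + complex.Im c * complex.Re (f x).
  by apply/funext => x; rewrite ImM.
rewrite !meanD; try exact: cr.
rewrite !meanZ //; case: c => a b /=.
by apply/eqP; rewrite eq_complex /=; apply/andP; split; apply/eqP; ring.
Qed.

Lemma cmean_sum {I : Type} (r : seq I) (f : I -> R -> C) :
  (forall i, ccontinuous (f i)) ->
  cmean (fun x => \sum_(i <- r) f i x) = \sum_(i <- r) cmean (f i).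
Proof.
move=> h; elim: r => [|i r IH].
  under eq_fun do rewrite big_nil; rewrite big_nil.
  by have := cmeanZ 0 _ (ccontinuous_cst 0); rewrite !mul0r.
rewrite big_cons -IH -cmeanD //; last exact: ccontinuous_sum.
by congr cmean; apply/funext => x; rewrite big_cons.
Qed.

Lemma cmean_conj (f : R -> C) : ccontinuous f ->
  cmean (fun x => conjc (f x)) = conjc (cmean f).
Proof.
move=> [fr fi]; rewrite /cmean /=.
under eq_fun do rewrite ReJ; congr Complex.
rewrite -mulN1r -meanZ //; congr mean.
by apply/funext => x; rewrite ImJ mulN1r.
Qed.

Lemma cmean_shift (f : R -> C) (a : R) : ccontinuous f ->
  (forall x, f (x + 1) = f x) -> cmean (fun x => f (x + a)) = cmean f.
Proof.
move=> [fr fi] f1; rewrite /cmean; congr Complex.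
- by rewrite (mean_shift (fun x => complex.Re (f x))) // => x; rewrite f1.
- by rewrite (mean_shift (fun x => complex.Im (f x))) // => x; rewrite f1.
Qed.

(** * Characters of the circle *)

Lemma cexp2piDk (j k : int) (x : R) :
  cexp2pi (j + k) x = cexp2pi j x * cexp2pi k x.
Proof.
rewrite /cexp2pi rmorphD /=.
have -> : 2 * pi * (j%:~R + k%:~R) * x = 2 * pi * j%:~R * x + 2 * pi * k%:~R * x :> R by ring.
by rewrite cosD sinD; apply/eqP; rewrite eq_complex /=; apply/andP; split; apply/eqP; ring.
Qed.

Lemma cexp2piDx (k : int) (x y : R) :
  cexp2pi k (x + y) = cexp2pi k x * cexp2pi k y.
Proof.
rewrite /cexp2pi mulrDr cosD sinD.
by apply/eqP; rewrite eq_complex /=; apply/andP; split; apply/eqP; ring.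
Qed.

Lemma cexp2pi_conj (k : int) (x : R) : conjc (cexp2pi k x) = cexp2pi (- k) x.
Proof. by rewrite /cexp2pi /= rmorphN /= mulrN mulNr cosN sinN. Qed.

Lemma cexp2piNx (k : int) (x : R) : cexp2pi k (- x) = cexp2pi (- k) x.
Proof. by rewrite /cexp2pi rmorphN /= !mulrN mulNr. Qed.

Lemma cexp2pi0 (x : R) : cexp2pi 0 x = 1.
Proof. by rewrite /cexp2pi !mulr0 mul0r cos0 sin0. Qed.

Lemma cexp2pi_int (k n : int) : cexp2pi k (n%:~R : R) = 1.
Proof.
have h1 : cexp2pi 1 (1 : R) = 1.
  by rewrite /cexp2pi !mulr1 mulr_natl cos2pi sin2pi.
have hn (m : nat) : cexp2pi m%:Z (1 : R) = 1.
  by elim: m => [|m IH]; rewrite ?cexp2pi0 // intS cexp2piDk h1 mul1r.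
have hz (j : int) : cexp2pi j (1 : R) = 1.
  by case: j => m //; rewrite NegzE -cexp2pi_conj hn rmorph1.
rewrite -[RHS](hz (k * n)) /cexp2pi rmorphM /=.
by rewrite mulr1 -!mulrA.
Qed.

Lemma cexp2pi_periodic (k : int) (x : R) : cexp2pi k (x + 1) = cexp2pi k x.
Proof. by rewrite cexp2piDx (cexp2pi_int k 1) mulr1. Qed.

Lemma cexp2pi_half_period (k : int) (x : R) : k != 0 ->
  cexp2pi k (x + (2 * k%:~R)^-1) = - cexp2pi k x.
Proof.
move=> k0; rewrite cexp2piDx (_ : cexp2pi k _^-1 = -1) ?mulrN1 //.
have kr : k%:~R != 0 :> R by rewrite intr_eq0.
have e : 2 * pi * k%:~R * (2 * k%:~R)^-1 = pi :> R by field.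
by rewrite /cexp2pi e cospi sinpi; apply/eqP; rewrite eq_complex /= oppr0 !eqxx.
Qed.

Lemma cexp2pi_continuous (k : int) : ccontinuous (@cexp2pi R k).
Proof.
have h : continuous (fun x : R => 2 * pi * k%:~R * x).
  by move=> x; apply: cvgM; [exact: cvg_cst | exact: cvg_id].
split=> x /=.
- by apply: (cvg_comp _ (@cos R) (h x)); exact: continuous_cos.
- by apply: (cvg_comp _ (@sin R) (h x)); exact: continuous_sin.
Qed.

Lemma sqc_cexp2pi (k : int) (x : R) : sqc (cexp2pi k x) = 1.
Proof. by rewrite /sqc /= cos2Dsin2. Qed.

(** For k != 0, translation by half a period preserves the mean and changes its sign. *)
Lemma cmean_cexp2pi (k : int) : cmean (@cexp2pi R k) = (k == 0)%:R.
Proof.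
have cst1 : mean (fun=> 1) = 1 :> R.
  have [|c _ ->] := mean_value (fun=> 1) => //.
  by move=> x; exact: cvg_cst.
have cst0 : mean (fun=> 0) = 0 :> R.
  have [|c _ ->] := mean_value (fun=> 0) => //.
  by move=> x; exact: cvg_cst.
case: (eqVneq k 0) => [->|k0].
  rewrite (_ : cexp2pi 0 = fun=> 1) ?/cmean ?cst1 ?cst0 //.
  by apply/funext => x; rewrite cexp2pi0.
have := cmean_shift _ (2 * k%:~R)^-1 (cexp2pi_continuous k) (cexp2pi_periodic k).
under eq_fun do rewrite cexp2pi_half_period // -mulN1r.
rewrite cmeanZ ?mulN1r; last exact: cexp2pi_continuous.
by case: (cmean _) => a b [ha hb]; apply/eqP; rewrite eq_complex /=;
   apply/andP; split; apply/eqP; lra.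
Qed.

End Means.

(** * Fourier coefficients *)

Section FourierCoefficients.
Local Open Scope classical_set_scope.
Context {R : realType}.
Local Notation C := R[i].
Implicit Types f g F G : R -> R.

(** Continuity is proved at the centre of each expansion: convergence at x0 + p bounds the terms |c
    j| p^j, and comparison with a geometric series gives a Lipschitz estimate at x0 for |x - x0| <=
    p / 2. *)
Lemma real_analytic_continuous f : real_analytic f -> continuous f.
Proof.
move=> fa x0; have [r [r0 [c hc]]] := fa x0.
pose s (x : R) (n : nat) := \sum_(j < n) c j * (x - x0) ^+ j.
have hs x : `|x - x0| < r -> s x @ \oo --> f x by exact: hc.
pose p := r / 2; have p0 : 0 < p by rewrite divr_gt0.
have c1 : s x0 @ \oo --> c 0%N.
  rewrite -(cvg_shiftS (s x0)) (_ : (fun n => s x0 n.+1) = fun=> c 0%N).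
    exact: cvg_cst.
  apply/funext => n; rewrite /s big_ord_recl /= expr0 mulr1 big1 ?addr0 // => i _.
  by rewrite subrr expr0n mulr0.
have hx0 : `|x0 - x0| < r by rewrite subrr normr0.
have fx0 : f x0 = c 0%N by apply: (cvg_unique _ (hs _ hx0) c1).
have [M M0 hM] : exists2 M : R, 0 < M & forall j, `|c j| * p ^+ j <= M.
  have : cvgn (s (x0 + p)).
    apply/cvg_ex; exists (f (x0 + p)); apply: hs.
    by rewrite addrAC subrr add0r gtr0_norm // /p ltr_pdivrMr // mulr_natr mulr2n ltrDl.
  move/cvg_seq_bounded => [B [_ hB]].
  pose b := `|B| + 1; have hb n : `|s (x0 + p) n| <= b.
    by apply: (hB b) => //; rewrite /b (le_lt_trans (ler_norm _)) // ltrDl.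
  exists (b + b) => [|j]; first by rewrite addr_gt0 // /b ltr_wpDl.
  have -> : `|c j| * p ^+ j = `|s (x0 + p) j.+1 - s (x0 + p) j|.
    by rewrite /s big_ord_recr /= addrAC subrr add0r addrAC subrr add0r normrM
      normrX (gtr0_norm p0).
  by rewrite (le_trans (ler_normB _ _)) // lerD.
have lip x : `|x - x0| <= p / 2 -> `|f x - f x0| <= 2 * M / p * `|x - x0|.
  move=> hx; pose t := `|x - x0| / p.
  have t0 : 0 <= t by rewrite divr_ge0 // ltW.
  have t1 : t <= 2^-1 by rewrite ler_pdivrMr // mulrC.
  (* The bracket is the sum of 2^-j for j < n. *)
  have hn n : `|s x n.+1 - c 0%N| <= M * t * (2 - 2 * 2^-1 ^+ n).
    elim: n => [|n IH].
      by rewrite /s big_ord_recr big_ord0 /= !expr0 mulr1 add0r subrr normr0 mulr1 subrr mulr0.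
    rewrite /s big_ord_recr /= -/(s x n.+1) addrAC (le_trans (ler_normD _ _)) //.
    have h2 : `|c n.+1 * (x - x0) ^+ n.+1| <= M * t * 2^-1 ^+ n.
      rewrite normrM normrX (_ : `|x - x0| = p * t); last first.
        by rewrite /t mulrC divfK // gt_eqF.
      rewrite exprMn mulrA -[leRHS]mulrA; apply: ler_pM; last 2 first.
      - exact: hM.
      - by rewrite exprS ler_wpM2l // lerXn2r // nnegrE.
      - by rewrite mulr_ge0 ?exprn_ge0 // ltW.
      - by rewrite exprn_ge0.
    rewrite (le_trans (lerD IH h2)) // exprS le_eqVlt; apply/orP; left.
    by apply/eqP; field.
  have xr : `|x - x0| < r.
    by rewrite (le_lt_trans hx) // /p; lra.
  have h3 : (fun n => `|s x n.+1 - c 0%N|) @ \oo --> `|f x - c 0%N|.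
    apply: cvg_norm; apply: cvgB; last exact: cvg_cst.
    by rewrite (cvg_shiftS (s x)); exact: hs.
  rewrite fx0; apply: (cvgr_to_le h3); apply: nearW => n.
  rewrite (le_trans (hn n)) // (_ : 2 * M / p * _ = M * t * 2); last by rewrite /t; ring.
  apply: ler_wpM2l; first by rewrite mulr_ge0 // ltW.
  by rewrite lerBlDr lerDl mulr_ge0 // exprn_ge0.
have K0 : 0 < 2 * M / p by rewrite divr_gt0 // mulr_gt0.
apply/cvgrPdist_le => e e0; near=> x.
have hx : `|x - x0| <= p / 2.
  near: x; apply: cvgr_distC_le; [exact: cvg_id | by rewrite divr_gt0].
rewrite distrC (le_trans (lip x hx)) // mulrC -ler_pdivlMr //.
near: x; apply: cvgr_distC_le; [exact: cvg_id | exact: divr_gt0 e0 K0].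
Unshelve. all: by end_near.
Qed.

(** Heine's theorem on the circle, by the ultrafilter argument of [uniform_gap]: counterexamples are
    moved into [0, 1], and their increments tend to 0. *)
Lemma uniform_shift g (eps : R) : continuous g -> (forall x, g (x + 1) = g x) ->
  0 < eps -> exists2 delta : R, 0 < delta &
    forall x a : R, `|a| <= delta -> `|g x - g (x + a)| <= eps.
Proof.
move=> gc g1 e0; apply: contrapT => hno.
have hseq (n : nat) : exists z : R * R,
    [/\ 0 <= z.1 <= 1, `|z.2| <= harmonic n & eps <= `|g z.1 - g (z.1 + z.2)|].
  apply: contrapT => hn; apply: hno; exists (harmonic n) => [|x a ha].
    exact: harmonic_gt0.
  rewrite leNgt; apply/negP => /ltW gh; apply: hn.
  pose y := x - (Num.floor x)%:~R; exists (y, a) => /=; split=> //.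
  - have /andP[h1 h2] := floor_itv x.
    by rewrite subr_ge0 h1 /= lerBlDl (le_trans (ltW h2)) // rmorphD.
  - have e t : g (t - (Num.floor x)%:~R) = g t.
      by rewrite -[in RHS](subrK (Num.floor x)%:~R t) (periodic_int g g1).
    by rewrite /y addrAC !e.
have [z hz] := choice hseq.
have [U [UU hU]] := ultraFilterLemma (@eventually_filter).
have PU : ProperFilter U := @ultra_proper _ _ UU.
have [x hx _] := ultra_bounded_cvg (fun n => (z n).1) 0 1 UU
  (fun n => let: And3 h _ _ := hz n in h).
have harmU : @harmonic R @ U --> (0 : R).
  by apply: cvg_trans cvg_harmonic; move=> V; exact: hU.
have h0 : (fun n => (z n).2) @ U --> (0 : R).
  apply/cvgr0Pnorm_le => e e1; near=> n; have [_ hn _] := hz n.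
  rewrite (le_trans hn) // (le_trans (ler_norm _)) //.
  near: n; exact: (cvgr0_norm_le _ harmU).
have h1 : (fun n => (z n).1 + (z n).2) @ U --> x.
  by rewrite -[x in X in _ --> X]addr0; exact: cvgD.
have c1 := cvg_comp _ g hx (gc x).
have c2 := cvg_comp _ g h1 (gc x).
have c3 : (fun n => `|g (z n).1 - g ((z n).1 + (z n).2)|) @ U --> `|g x - g x|.
  by apply: cvg_norm; apply: cvgB.
have : eps <= `|g x - g x|.
  by apply: (cvgr_to_ge c3); apply: nearW => n; have [] := hz n.
by rewrite subrr normr0 leNgt e0.
Unshelve. all: by end_near.
Qed.

Lemma periodic_bounded g : continuous g -> (forall x, g (x + 1) = g x) ->
  exists2 B : R, 0 < B & forall x, `|g x| <= B.
Proof.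
move=> gc g1.
have nc : {within `[0, 1], continuous (fun x => `|g x|)}.
  apply: continuous_subspaceT => x; apply: cvg_norm; exact: gc.
have [c _ hc] := EVT_max (@ler01 R) nc.
exists (`|g c| + 1) => [|x]; first by rewrite ltr_wpDl.
have /andP[h1 h2] := floor_itv x.
rewrite -(subrK (Num.floor x)%:~R x) (periodic_int g g1) (le_trans (hc _ _)) ?lerDl //.
by rewrite in_itv /= subr_ge0 h1 /= lerBlDl (le_trans (ltW h2)) // rmorphD.
Qed.

(** The factor 2 is due to the real and imaginary parts attaining their means at different
    points. *)
Lemma cmean_bound (f : R -> C) (e : R) : ccontinuous f ->
  (forall x, sqc (f x) <= e) -> sqc (cmean f) <= 2 * e.
Proof.
move=> [fr fi] h; rewrite /sqc /cmean /=.
have [c _ ->] := mean_value _ fr; have [c' _ ->] := mean_value _ fi.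
have h1 := h c; have h2 := h c'; rewrite /sqc in h1 h2.
have := sqr_ge0 (complex.Im (f c)); have := sqr_ge0 (complex.Re (f c')); lra.
Qed.

(** In the usual convention this is the coefficient of index -n. With this sign, multiplying g by
    [cexp2pi k] moves the index from n to n + k, as in the operator. *)
Definition fcoef g (n : int) : C := cmean (fun x => (g x)%:C * cexp2pi n x).

Lemma fcoef_integrand_continuous g n : continuous g ->
  ccontinuous (fun x => (g x)%:C * cexp2pi n x).
Proof.
move=> gc; apply: ccontinuousM; first exact: ccontinuous_real.
exact: cexp2pi_continuous.
Qed.

Lemma fcoef_shift g (a : R) n : continuous g -> (forall x, g (x + 1) = g x) ->
  fcoef (fun x => g (x + a)) n = cexp2pi n (- a) * fcoef g n.
Proof.
move=> gc g1; rewrite /fcoef.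
have c1 := fcoef_integrand_continuous g n gc.
rewrite -(cmean_shift _ a c1) => [|x]; last by rewrite g1 cexp2pi_periodic.
rewrite -cmeanZ; last first.
  exact: (ccontinuous_shiftr (fun x => (g x)%:C * cexp2pi n x)).
congr cmean; apply/funext => x.
rewrite mulrCA; congr (_ * _).
by rewrite cexp2piDx mulrCA -cexp2piDx addNr (cexp2pi_int n 0) mulr1.
Qed.

Lemma fcoefD g (h : R -> R) n : continuous g -> continuous h ->
  fcoef (fun x => g x + h x) n = fcoef g n + fcoef h n.
Proof.
move=> gc hc; rewrite /fcoef -cmeanD; try exact: fcoef_integrand_continuous.
by congr cmean; apply/funext => x; rewrite rmorphD mulrDl.
Qed.

Lemma fcoefZ g (a : R) n : continuous g -> fcoef (fun x => a * g x) n = a%:C * fcoef g n.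
Proof.
move=> gc; rewrite /fcoef -cmeanZ; last exact: fcoef_integrand_continuous.
by congr cmean; apply/funext => x; rewrite rmorphM mulrA.
Qed.

Lemma fcoef_conj g n : continuous g -> conjc (fcoef g n) = fcoef g (- n).
Proof.
move=> gc; rewrite /fcoef -cmean_conj; last exact: fcoef_integrand_continuous.
congr cmean; apply/funext => x.
have -> : conjc ((g x)%:C * cexp2pi n x) = conjc (g x)%:C * conjc (cexp2pi n x).
  exact: (rmorphM (@conjc R)).
by rewrite conjc_real cexp2pi_conj.
Qed.

(* Translating by half a period of cexp2pi n changes its sign, so that twice the
   coefficient is the mean of a small increment of g times cexp2pi n. *)
Lemma riemann_lebesgue g (eps : R) : continuous g -> (forall x, g (x + 1) = g x) ->
  0 < eps -> exists M : nat, forall n : int, (M <= absz n)%N -> sqc (fcoef g n) <= eps.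
Proof.
(* The estimate obtained is 4 |fcoef g n|^2 <= 2 e^2; as e is at most 1 and at most eps, it gives
   the bound eps. *)
move=> gc g1 e0; pose e := Num.min 1 eps.
have e00 : 0 < e by rewrite lt_min ltr01.
have [delta d0 hd] := uniform_shift g e gc g1 e00.
(* This makes the half period 1 / (2 |n|) smaller than delta. *)
exists (Num.truncn delta^-1).+1 => n hn.
have n0 : n != 0 by apply: contraTneq hn => ->.
pose a : R := (2 * n%:~R)^-1.
have ha : `|a| <= delta.
  have nn : `|n%:~R| = (absz n)%:R :> R by rewrite natr_absz intr_norm.
  rewrite /a normfV normrM nn ger0_norm // -[leRHS]invrK lef_pV2 ?posrE ?invr_gt0 //.
    rewrite (le_trans (ltW (truncnS_gt _))) // (@le_trans _ _ (absz n)%:R) ?ler_nat //.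
    by rewrite ler_peMl // ler1n.
  by rewrite mulr_gt0 // ltr0n absz_gt0.
pose k x := g x - g (x + a).
have gac := continuous_shiftr g a gc.
have kc : continuous k by move=> x; apply: cvgB; [exact: gc | exact: gac].
have hk : fcoef k n = 2%:R * fcoef g n.
  rewrite (_ : k = fun x => g x + (-1) * g (x + a)); last first.
    by apply/funext => x; rewrite mulN1r.
  rewrite fcoefD //; last by move=> x; apply: cvgM; [exact: cvg_cst | exact: gac].
  rewrite fcoefZ // fcoef_shift // cexp2piNx (_ : cexp2pi _ a = -1).
    by rewrite rmorphN rmorph1 mulrA mulrNN !mul1r -mulr2n mulr_natl.
  have := cexp2pi_half_period n (0 : R) n0.
  rewrite add0r -/a (cexp2pi_int n 0) -cexp2pi_conj => ->.
  by rewrite rmorphN rmorph1.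
have : sqc (fcoef k n) <= 2 * e ^+ 2.
  apply: cmean_bound; first exact: fcoef_integrand_continuous.
  move=> x; rewrite sqcM sqc_cexp2pi mulr1 /sqc /= expr0n addr0.
  by rewrite -real_normK ?num_real // lerXn2r ?nnegrE // ?(ltW e00) // hd.
rewrite hk sqcM (_ : sqc 2%:R = 4); last first.
  by rewrite /sqc /=; ring.
have e1 : e <= 1 by rewrite ge_min lexx.
have e2 : e <= eps by rewrite ge_min lexx orbT.
have := sqc_ge0 (fcoef g n); nra.
Qed.

End FourierCoefficients.

(** * Uniqueness of Fourier coefficients *)

Section FourierUniqueness.
Local Open Scope classical_set_scope.
Context {R : realType}.
Local Notation C := R[i].
Implicit Types f g F G : R -> R.

Lemma continuous_cos2pi : continuous (fun x : R => cos (2 * pi * x)).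
Proof.
move=> x; apply: (cvg_comp (fun x : R => 2 * pi * x) (@cos R)); last exact: continuous_cos.
by apply: cvgM; [exact: cvg_cst | exact: cvg_id].
Qed.

(** The cosine is half the sum of two characters. Consequently, multiplication by t + cos keeps all
    coefficients zero if they were zero. *)
Lemma fcoef_mul_cos g (t : R) n : continuous g ->
  fcoef (fun x => g x * (t + cos (2 * pi * x))) n =
  t%:C * fcoef g n + 2^-1%:C * (fcoef g (n + 1) + fcoef g (n - 1)).
Proof.
move=> gc; rewrite /fcoef.
have hc k := fcoef_integrand_continuous g k gc.
have hZ (c : C) (f : R -> C) : ccontinuous f -> ccontinuous (fun x => c * f x).
  by move=> fc; apply: ccontinuousM => //; exact: ccontinuous_cst.
rewrite -cmeanD // -!cmeanZ //; last exact: ccontinuousD.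
rewrite -cmeanD; [|exact: hZ|by apply: hZ; exact: ccontinuousD].
congr cmean; apply/funext => x; rewrite !cexp2piDk -cexp2pi_conj.
have -> : (g x * (t + cos (2 * pi * x)))%:C =
    (g x)%:C * (t%:C + (2^-1)%:C * (cexp2pi 1 x + conjc (cexp2pi 1 x))).
  rewrite /cexp2pi !mulr1; apply/eqP; rewrite eq_complex /=.
  by apply/andP; split; apply/eqP; field.
ring.
Qed.

Lemma primitive_ge f F (a b m : R) : is_primitive f F -> a <= b ->
  (forall x, a <= x <= b -> m <= f x) -> m * (b - a) <= F b - F a.
Proof.
move=> hF ab hm; have [c cab ->] := primitive_increment _ _ _ _ hF ab.
by rewrite ler_wpM2r ?subr_ge0 // hm.
Qed.

Lemma cos2pi_lt (x y : R) : 0 <= x -> x < y -> y <= 2^-1 ->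
  cos (2 * pi * y) < cos (2 * pi * x).
Proof.
move=> x0 xy y1; have p0 := @pi_gt0 R; have y0 := le_trans x0 (ltW xy).
have H (z : R) : 0 <= z -> z <= 2^-1 -> 2 * pi * z \in `[0, pi]%R.
  move=> z0 z1; rewrite in_itv /= !mulr_ge0 ?(ltW p0) //=.
  have -> : 2 * pi * z = pi * (2 * z) by ring.
  by rewrite ger_pMr //; lra.
rewrite ltr_cos ?H // ?ltr_pM2l ?mulr_gt0 //.
exact: le_trans (ltW xy) y1.
Qed.

Lemma cos2pi_le (x y : R) : 0 <= x -> x <= y -> y <= 2^-1 ->
  cos (2 * pi * y) <= cos (2 * pi * x).
Proof.
by rewrite [x <= y]le_eqVlt => x0 /predU1P[->//|xy] y1; rewrite ltW // cos2pi_lt.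
Qed.

(* The powers of T x = 1 + cos (2 pi x) - cos (2 pi delta) are bounded by 1 away
   from the integers and grow exponentially near 0, while the mean of g times any
   trigonometric polynomial vanishes. *)
Lemma fcoef_eq0_nonpos g : continuous g -> (forall x, g (x + 1) = g x) ->
  (forall n, fcoef g n = 0) -> g 0 <= 0.
Proof.
move=> gc g1 g0; rewrite leNgt; apply/negP => gp.
pose c := g 0 / 2; have c0 : 0 < c by rewrite divr_gt0.
have [B B0 hB] := periodic_bounded _ gc g1.
have [e e0 he] := uniform_shift _ _ gc g1 c0.
(* The bound 1/4 places delta inside [0, 1/2], where cos (2 pi x) decreases, and before 1 -
   delta. *)
pose delta := Num.min e (2^-1 / 2).
have d0 : 0 < delta by rewrite lt_min e0; lra.
have dq : delta <= 2^-1 / 2 by rewrite ge_min lexx orbT.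
have hpos (x : R) : - delta <= x <= delta -> c <= g x.
  move=> hx; have := he 0 x; rewrite add0r => /(_ _) h.
  have xe : `|x| <= e by rewrite (@le_trans _ _ delta) ?ler_norml // ge_min lexx.
  have := h xe; rewrite ler_norml => /andP[_]; rewrite /c; lra.
pose T (x : R) := 1 - cos (2 * pi * delta) + cos (2 * pi * x).
have Tc : continuous T.
  by move=> x; apply: cvgD; [exact: cvg_cst | exact: continuous_cos2pi].
have T1 x : T (x + 1) = T x.
  rewrite /T; congr (_ + _); have := cexp2pi_periodic 1 x.
  by rewrite /cexp2pi !mulr1 => -[].
pose gk k (x : R) := g x * T x ^+ k.
have gkO : gk 0%N = g by apply/funext => x; rewrite /gk expr0 mulr1.
have gkS k : gk k.+1 = fun x => gk k x * T x.
  by apply/funext => x; rewrite /gk exprSr mulrA.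
have gkc k : continuous (gk k).
  elim: k => [|k IH]; first by rewrite gkO.
  by rewrite gkS => x; apply: cvgM; [exact: IH | exact: Tc].
have gk0 k n : fcoef (gk k) n = 0.
  elim: k n => [|k IH] n; first by rewrite gkO.
  by rewrite gkS fcoef_mul_cos // !IH addr0 !mulr0 addr0.
have meank k : mean (gk k) = 0.
  have := gk0 k 0; rewrite /fcoef; under eq_fun do rewrite cexp2pi0 mulr1.
  by case.
have cosN2 (x : R) : cos (2 * pi * - x) = cos (2 * pi * x) by rewrite mulrN cosN.
have Tabs (x : R) : T `|x| = T x.
  have [x0|x0] := lerP 0 x; first by rewrite ger0_norm.
  by rewrite ltr0_norm // /T cosN2.
have T_in (x : R) : - delta <= x <= delta -> 1 <= T x.
  rewrite -ler_norml -Tabs => hx.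
  have := cos2pi_le _ _ (normr_ge0 x) hx; rewrite /T => h.
  have : delta <= 2^-1 by lra.
  by move=> /h; lra.
pose q := T (delta / 2).
have q1 : 1 < q.
  have : cos (2 * pi * delta) < cos (2 * pi * (delta / 2)).
    by apply: cos2pi_lt; lra.
  rewrite /q /T; lra.
have T_mid (x : R) : - (delta / 2) <= x <= delta / 2 -> q <= T x.
  rewrite -ler_norml -Tabs => hx.
  have := cos2pi_le _ _ (normr_ge0 x) hx; rewrite /q /T => h.
  have : delta / 2 <= 2^-1 by lra.
  by move=> /h; lra.
have T_out (x : R) : delta <= x <= 1 - delta -> `|T x| <= 1.
  move=> /andP[x1 x2].
  have h : cos (2 * pi * x) <= cos (2 * pi * delta).
    have [xh|xh] := lerP x 2^-1; first by apply: cos2pi_le => //; exact: ltW.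
    rewrite -[in leLHS](cosN2 x).
    have := T1 (- x); rewrite /T => /addrI <-; apply: cos2pi_le; [exact: ltW|lra|lra].
  have := cos_le1 (2 * pi * delta); have := cos_geN1 (2 * pi * x).
  by rewrite ler_norml /T => *; apply/andP; split; lra.
(* The mean of g T^k, taken over [-delta, 1 - delta], is 0. It receives at least c delta q^k from
   the middle half of [-delta, delta], a nonnegative amount from the rest of that interval, and at
   least -B from outside, so c delta <= B q^-k. *)
suff : c * delta <= 0 by rewrite leNgt mulr_gt0.
apply: (le_geometric_le0 _ B q^-1 0) => [||k _].
- by rewrite invr_ge0 (le_trans _ (ltW q1)).
- by rewrite invf_lt1 // (lt_trans _ q1).
have [F hF] := primitive_exists _ (gkc k).
have F1 : F (1 - delta) - F (- delta) = 0.
  have := mean_shift _ (- delta) (gkc k) _.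
  rewrite meank (meanE _ (fun x => F (x - delta))) ?sub0r; last first.
    by move=> x; exact: is_derive_shiftr.
  by apply=> x; rewrite /gk g1 T1.
have i1 := primitive_ge _ _ (- delta) (- (delta / 2)) 0 hF.
have i2 := primitive_ge _ _ (- (delta / 2)) (delta / 2) (c * q ^+ k) hF.
have i3 := primitive_ge _ _ (delta / 2) delta 0 hF.
have i4 := primitive_ge _ _ delta (1 - delta) (- B) hF.
have q0 : 0 < q by lra.
rewrite exprVn ler_pdivlMr ?exprn_gt0 //.
have {}i1 : 0 * (- (delta / 2) - - delta) <= F (- (delta / 2)) - F (- delta).
  apply: i1; first lra.
  move=> x hx; have hx' : - delta <= x <= delta by move/andP: hx => [? ?]; apply/andP; split; lra.
  by rewrite mulr_ge0 // ?exprn_ge0 ?(le_trans _ (T_in _ hx')) // (le_trans _ (hpos _ hx')) // ltW.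
have {}i3 : 0 * (delta - delta / 2) <= F delta - F (delta / 2).
  apply: i3; first lra.
  move=> x hx; have hx' : - delta <= x <= delta by move/andP: hx => [? ?]; apply/andP; split; lra.
  by rewrite mulr_ge0 // ?exprn_ge0 ?(le_trans _ (T_in _ hx')) // (le_trans _ (hpos _ hx')) // ltW.
have {}i2 : c * q ^+ k * (delta / 2 - - (delta / 2)) <= F (delta / 2) - F (- (delta / 2)).
  apply: i2; first lra.
  move=> x hx; have hx' : - delta <= x <= delta by move/andP: hx => [? ?]; apply/andP; split; lra.
  apply: ler_pM; rewrite ?exprn_ge0 ?(ltW c0) ?(ltW q0) ?hpos //.
  by rewrite lerXn2r ?nnegrE ?(ltW q0) ?T_mid // (le_trans (ltW q0)) // T_mid.
have {}i4 : - B * (1 - delta - delta) <= F (1 - delta) - F delta.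
  apply: i4; first lra.
  move=> x hx; have : `|gk k x| <= B.
    rewrite normrM normrX -[leRHS]mulr1 ler_pM // ?exprn_ge0 //.
    by rewrite exprn_ile1 // T_out.
  by rewrite ler_norml => /andP[].
have e1 : c * delta * q ^+ k = c * q ^+ k * (delta / 2 - - (delta / 2)) by field.
have : B * delta >= 0 by rewrite mulr_ge0 // ltW.
rewrite e1; lra.
Qed.

(** The one-sided bound at 0 is applied to the translates of g and of -g. *)
Lemma fcoef_eq0 g : continuous g -> (forall x, g (x + 1) = g x) ->
  (forall n, fcoef g n = 0) -> forall x, g x = 0.
Proof.
move=> gc g1 g0 a.
have key (s : R) : s * g a <= 0.
  have gac := continuous_shiftr g a gc.
  have := fcoef_eq0_nonpos (fun x => s * g (x + a)); rewrite add0r; apply.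
  - by move=> x; apply: cvgM; [exact: cvg_cst | exact: gac].
  - by move=> x; rewrite addrAC g1.
  - by move=> n; rewrite fcoefZ // fcoef_shift // g0 !mulr0.
have := key 1; have := key (-1); lra.
Qed.

End FourierUniqueness.

(** * The dual equation *)

Section TrigonometricPolynomials.
Local Open Scope classical_set_scope.
Context {R : realType}.
Local Notation C := R[i].
Variables (m : nat) (ph : int -> C).

Lemma conjcM (x y : C) : conjc (x * y) = conjc x * conjc y.
Proof. exact: (rmorphM (@conjc R)). Qed.

Lemma conjcD (x y : C) : conjc (x + y) = conjc x + conjc y.
Proof. exact: (raddfD (@conjc R)). Qed.

Lemma conjc_sum (n : nat) (F : 'I_n -> C) :
  conjc (\sum_i F i) = \sum_i conjc (F i).
Proof. exact: (raddf_sum (@conjc R)). Qed.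

(** Decreasing frequencies follow the order of the columns of [transfer]. *)
Lemma trig_eval_rev (x : R) : trig_eval m ph x =
  \sum_(b < (m + m).+1) ph (m%:Z - b%:Z) * cexp2pi (m%:Z - b%:Z) x.
Proof.
rewrite /trig_eval (reindex_inj rev_ord_inj) /=; apply: eq_bigr => b _.
have -> : ((m + m).+1 - b.+1)%N%:Z - m%:Z = m%:Z - b%:Z.
  by have := ltn_ord b; lia.
by [].
Qed.

Lemma trig_eval_continuous : ccontinuous (@trig_eval R m ph).
Proof.
apply: ccontinuous_sum => j; apply: ccontinuousM; first exact: ccontinuous_cst.
exact: cexp2pi_continuous.
Qed.

Lemma trig_eval_periodic (x : R) : trig_eval m ph (x + 1) = trig_eval m ph x.
Proof. by apply: eq_bigr => j _; rewrite cexp2pi_periodic. Qed.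

Lemma cmean_trig_eval_mul (F : R -> C) : ccontinuous F ->
  cmean (fun x => trig_eval m ph x * F x) =
  \sum_(b < (m + m).+1) ph (m%:Z - b%:Z) * cmean (fun x => cexp2pi (m%:Z - b%:Z) x * F x).
Proof.
move=> Fc; have hc (k : int) : ccontinuous (fun x => cexp2pi k x * F x).
  by apply: ccontinuousM => //; exact: cexp2pi_continuous.
under [RHS]eq_bigr do rewrite -cmeanZ //.
rewrite -cmean_sum; last first.
  by move=> b; apply: ccontinuousM => //; exact: ccontinuous_cst.
congr cmean; apply/funext => x; rewrite trig_eval_rev mulr_suml.
by apply: eq_bigr => b _; rewrite mulrA.
Qed.

Lemma trig_coef (k : int) : (absz k <= m)%N ->
  cmean (fun x => trig_eval m ph x * cexp2pi (- k) x) = ph k.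
Proof.
move=> km; rewrite cmean_trig_eval_mul; last exact: cexp2pi_continuous.
have hb (b : 'I_(m + m).+1) :
    cmean (fun x : R => cexp2pi (m%:Z - b%:Z) x * cexp2pi (- k) x) =
    ((b : nat) == absz (m%:Z - k))%:R.
  rewrite (_ : (fun x => _) = cexp2pi (m%:Z - b%:Z - k)).
    by rewrite cmean_cexp2pi; congr (_%:R); congr nat_of_bool; lia.
  by apply/funext => x; rewrite -cexp2piDk.
under eq_bigr do rewrite hb mulrC.
rewrite (sum_delta _ _ (fun b => ph (m%:Z - b%:Z))) ifT; last lia.
by congr ph; lia.
Qed.

Hypothesis real : trig_real_valued m ph.

Lemma trig_eval_real (x : R) : trig_eval m ph x = (complex.Re (trig_eval m ph x))%:C.
Proof. by have := real x; case: (trig_eval m ph x) => a b /= ->. Qed.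

Lemma conj_trig_eval (x : R) : conjc (trig_eval m ph x) = trig_eval m ph x.
Proof. by rewrite trig_eval_real conjc_real. Qed.

(** The restriction |k| <= m is that of the values of [ph] which enter [trig_eval]; there the
    coefficient is recovered as a mean, and conjugation passes under the mean. *)
Lemma trig_coef_conj (k : int) : (absz k <= m)%N -> ph (- k) = conjc (ph k).
Proof.
move=> km; rewrite -(trig_coef k km) -(trig_coef (- k)) ?abszN // opprK -cmean_conj.
  congr cmean; apply/funext => x.
  by rewrite conjcM conj_trig_eval cexp2pi_conj opprK.
by apply: ccontinuousM; [exact: trig_eval_continuous | exact: cexp2pi_continuous].
Qed.

End TrigonometricPolynomials.

(** * Duality between shifts and multiplications *)

Section DualEquation.
Local Open Scope classical_set_scope.
Context {R : realType}.
Local Notation C := R[i].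

(** The first row solves the equation for its leading term, with the denominator cleared here.
    Position m - 1 is that of u_n in the vector (u_{n+m-1}, ..., u_{n-m}). *)
Lemma transfer_row_sum (m : nat) (ph : int -> C) (q E : R) (F : nat -> C) :
  (0 < m)%N -> ph m%:Z != 0 ->
  ph m%:Z * \sum_(a < m + m) F a * transfer_row m ph q E a =
  (E%:C - q%:C) * F m.-1 - \sum_(a < m + m) ph (m%:Z - a.+1%:Z) * F a.
Proof.
move=> m0 phm.
have <- : \sum_(a < m + m) ((a : nat) == m.-1)%:R * ((E%:C - q%:C) * F a) =
    (E%:C - q%:C) * F m.-1.
  by rewrite (sum_delta _ _ (fun a => (E%:C - q%:C) * F a)) ifT //; lia.
rewrite mulr_sumr -sumrB; apply: eq_bigr => a _.
have -> : ph m%:Z * (F a * transfer_row m ph q E a) =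
    F a * (transfer_row m ph q E a * ph m%:Z) by ring.
rewrite /transfer_row /= divfK //.
have -> : m%:Z - 1 - a%:Z = m%:Z - a.+1%:Z by lia.
case: eqP => [e|ne].
  have -> : ((a : nat) == m.-1) = true by lia.
  by rewrite e mul1r; ring.
have -> : ((a : nat) == m.-1) = false by lia.
by rewrite mul0r add0r mulrN mulrC.
Qed.

Lemma transfer_affine m (ph : int -> C) (E : R) (i j : 'I_(m + m)) :
  exists a b, forall qx, transfer m ph qx E i j = a + b * qx.
Proof.
have [i0|i0] := eqVneq (i : nat) 0%N; last first.
  exists ((j : nat) == i.-1)%:R, 0 => qx.
  by rewrite mxE (negbTE i0) mul0r addr0.
have [k0|k0] := eqVneq (m%:Z - 1 - j%:Z) 0.
  exists ((E%:C - ph 0) / ph m), (- (ph m)^-1) => qx.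
  by rewrite mxE i0 eqxx /= k0 eqxx; ring.
exists (- ph (m%:Z - 1 - j%:Z) / ph m), 0 => qx.
by rewrite mxE i0 eqxx /= (negbTE k0) mul0r addr0.
Qed.

Lemma transfer_fun_continuous m (ph : int -> C) n (qh : int -> C) (E : R) :
  mxcontinuous (transfer_fun m ph n qh E).
Proof.
move=> i j; have [a [b hab]] := transfer_affine m ph E i j.
rewrite (_ : (fun x => _) = fun x => a + b * trig_eval n qh x).
  apply: ccontinuousD; first exact: ccontinuous_cst.
  by apply: ccontinuousM; [exact: ccontinuous_cst | exact: trig_eval_continuous].
by apply/funext => x; exact: hab.
Qed.

Lemma transfer_fun_periodic m (ph : int -> C) n (qh : int -> C) (E : R) x :
  transfer_fun m ph n qh E (x + 1) = transfer_fun m ph n qh E x.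
Proof. by rewrite /transfer_fun trig_eval_periodic. Qed.

Variables (alpha E : R) (d l : nat) (vh wh : int -> C).
Hypothesis vreal : trig_real_valued d vh.
Hypothesis wreal : trig_real_valued l wh.

Definition finite_range_eq (g : R -> R) : Prop := forall x,
  \sum_(b < (l + l).+1) wh (l%:Z - b%:Z) * (g (x + (l%:Z - b%:Z)%:~R * alpha))%:C
    + trig_eval d vh x * (g x)%:C = E%:C * (g x)%:C.

(** Aubry duality: translation by k alpha becomes multiplication by a phase, and multiplication by v
    becomes a sum over shifted indices. *)
Lemma fcoef_dual_eq (g : R -> R) n : continuous g -> (forall x, g (x + 1) = g x) ->
  finite_range_eq g ->
  trig_eval l wh (n%:~R * alpha) * fcoef g n +
  \sum_(b < (d + d).+1) vh (d%:Z - b%:Z) * fcoef g (n + (d%:Z - b%:Z)) =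
  E%:C * fcoef g n.
Proof.
move=> gc g1 heq.
have gnc := fcoef_integrand_continuous g n gc.
pose gs (b : nat) x := g (x + (l%:Z - b%:Z)%:~R * alpha).
have gsc b : continuous (gs b) by exact: continuous_shiftr.
(* The equation is conjugated, g and v being real: the conjugate coefficients of w, paired with the
   phases [cexp2pi n (- k alpha)], sum to the conjugate of w (n alpha), which is w (n alpha). *)
have hx x : \sum_(b < (l + l).+1) conjc (wh (l%:Z - b%:Z)) * ((gs b x)%:C * cexp2pi n x)
    + trig_eval d vh x * ((g x)%:C * cexp2pi n x) = E%:C * ((g x)%:C * cexp2pi n x).
  have h : \sum_(b < (l + l).+1) conjc (wh (l%:Z - b%:Z)) * (gs b x)%:C
      + trig_eval d vh x * (g x)%:C = E%:C * (g x)%:C.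
    have := congr1 (@conjc R) (heq x).
    rewrite conjcD conjc_sum !conjcM !conjc_real conj_trig_eval // => <-.
    congr (_ + _); apply: eq_bigr => b _.
    by rewrite conjcM conjc_real.
  rewrite [RHS]mulrA -h mulrDl; congr (_ + _); last by rewrite mulrA.
  by rewrite mulr_suml; apply: eq_bigr => b _; rewrite mulrA.
have hs : ccontinuous (fun x =>
   \sum_(b < (l + l).+1) conjc (wh (l%:Z - b%:Z)) * ((gs b x)%:C * cexp2pi n x)).
  apply: ccontinuous_sum => b; apply: ccontinuousM; first exact: ccontinuous_cst.
  exact: fcoef_integrand_continuous.
have := congr1 cmean (funext hx).
rewrite cmeanD //; last first.
  by apply: ccontinuousM => //; exact: trig_eval_continuous.
rewrite cmeanZ // cmean_trig_eval_mul // cmean_sum; last first.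
  move=> b; apply: ccontinuousM; first exact: ccontinuous_cst.
  exact: fcoef_integrand_continuous.
rewrite -/(fcoef g n) => <-; congr (_ + _).
  rewrite -conj_trig_eval // trig_eval_rev conjc_sum mulr_suml.
  apply: eq_bigr => b _; rewrite cmeanZ; last exact: fcoef_integrand_continuous.
  rewrite -/(fcoef (gs b) n) fcoef_shift // mulrA; congr (_ * _).
  rewrite conjcM; congr (_ * _).
  rewrite cexp2pi_conj cexp2piNx /cexp2pi !rmorphN /=.
  by congr (Complex (cos _) (sin _)); ring.
apply: eq_bigr => b _; congr (_ * _); congr cmean; apply/funext => x.
by rewrite mulrCA -cexp2piDk addrC.
Qed.

(** The state vector (u_{n+d-1}, ..., u_{n-d}) of the recursion, with u the coefficients of g. *)
Definition coef_orbit (g : R -> R) (n : int) : 'cV[C]_(d + d) :=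
  \col_(i < d + d) fcoef g (n + (d%:Z - i.+1%:Z)).

Lemma coef_orbit_is_orbit (g : R -> R) : (0 < d)%N -> vh d%:Z != 0 ->
  continuous g -> (forall x, g (x + 1) = g x) -> finite_range_eq g ->
  is_orbit alpha (d + d)%N (transfer_fun d vh l wh E) (coef_orbit g).
Proof.
move=> d0 vd0 gc g1 heq n; apply/colP => i.
pose q := complex.Re (trig_eval l wh (n%:~R * alpha)).
pose F (a : nat) := fcoef g (n + (d%:Z - a.+1%:Z)).
rewrite /transfer_fun trig_eval_real // -/q mxE [RHS]mxE.
have -> : \sum_j transfer d vh q%:C E i j * coef_orbit g n j 0 =
    ((i : nat) == 0%N)%:R * (\sum_(a < d + d) F a * transfer_row d vh q E a) +
    \sum_(a < d + d) ((a : nat).+1 == i)%:R * F a.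
  rewrite mulr_sumr -big_split; apply: eq_bigr => a _ /=.
  by rewrite transferE mxE -/(F a) mulrDl (eq_sym _ a.+1) -mulrA (mulrC (F a)).
case: i => [[|i] hi] /=.
  rewrite mul1r [X in _ = _ + X]big1 ?addr0; last by move=> a _; rewrite mul0r.
  apply: (mulfI vd0); rewrite transfer_row_sum //.
  have := fcoef_dual_eq g n gc g1 heq; rewrite trig_eval_real // -/q.
  rewrite big_ord_recl /= subr0.
  have -> : F d.-1 = fcoef g n by rewrite /F; congr fcoef; lia.
  have -> : n + 1 + (d%:Z - 1%:Z) = n + d%:Z by lia.
  have -> : \sum_(b < d + d) vh (d%:Z - (bump 0 b)%:Z) *
      fcoef g (n + (d%:Z - (bump 0 b)%:Z)) =
      \sum_(a < d + d) vh (d%:Z - a.+1%:Z) * F a by [].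
  by rewrite mulrBl => <-; ring.
rewrite mul0r add0r.
under eq_bigr do rewrite eqSS.
by rewrite sum_delta ifT 1?ltnW // /F; congr fcoef; lia.
Qed.

Lemma coef_orbit_vanishes (g : R -> R) : continuous g -> (forall x, g (x + 1) = g x) ->
  vanishes_at_infinity (d + d)%N (coef_orbit g).
Proof.
move=> gc g1 eps e0.
have e1 : 0 < eps / (d + d).+1%:R by rewrite divr_gt0.
have [M hM] := riemann_lebesgue _ _ gc g1 e1.
(* The margin absorbs the offsets of the indices in the state vector. *)
exists (M + (d + d))%N => n hn.
rewrite normsqE (@le_trans _ _ (\sum_(i < d + d) eps / (d + d).+1%:R)) //.
  by apply: ler_sum => i _; rewrite mxE hM //; have := ltn_ord i; lia.
rewrite sumr_const card_ord -[_ *+ (d + d)]mulr_natl mulrCA ger_pMr // ler_pdivrMr ?ltr0n //.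
by rewrite mul1r ler_nat.
Qed.

(** As each g j is real, conjugating the relation at -n shows that the conjugate of z satisfies it
    as well. So do the real and imaginary parts of z, to which uniqueness for real functions
    applies. *)
Lemma fcoef_combination_eq0 (g : 'I_2 -> R -> R) (z : 'I_2 -> C) :
  (forall j, continuous (g j)) -> (forall j x, g j (x + 1) = g j x) ->
  (forall n, \sum_j z j * fcoef (g j) n = 0) ->
  forall x, \sum_j complex.Re (z j) * g j x = 0 /\ \sum_j complex.Im (z j) * g j x = 0.
Proof.
move=> gc g1 hz.
have hz' n : \sum_j conjc (z j) * fcoef (g j) n = 0.
  have := congr1 (@conjc R) (hz (- n)); rewrite conjc_sum conjc0 => h.
  rewrite -[RHS]h; apply: eq_bigr => j _.
  by rewrite conjcM fcoef_conj // opprK.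
have key (r : 'I_2 -> R) : (forall n, \sum_j (r j)%:C * fcoef (g j) n = 0) ->
    forall x, \sum_j r j * g j x = 0.
  move=> hr; have rc j : continuous (fun x => r j * g j x).
    by move=> x; apply: cvgM; [exact: cvg_cst | exact: gc].
  have e : (fun x => \sum_j r j * g j x) =
      fun x => r ord0 * g ord0 x + r (lift ord0 ord0) * g (lift ord0 ord0) x.
    by apply/funext => x; rewrite !big_ord_recl big_ord0 addr0.
  apply: fcoef_eq0.
  - by rewrite e => x; apply: cvgD; exact: rc.
  - by move=> x; apply: eq_bigr => j _; rewrite g1.
  - move=> n; rewrite e fcoefD // !fcoefZ // -[RHS](hr n).
    by rewrite !big_ord_recl big_ord0 addr0.
move=> x; split; apply: key => n.
- apply: (@mulfI _ (2%:R : C)); first by rewrite pnatr_eq0.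
  have e : \sum_j z j * fcoef (g j) n + \sum_j conjc (z j) * fcoef (g j) n = 0.
    by rewrite hz hz' addr0.
  rewrite mulr0 -[RHS]e -big_split mulr_sumr.
  by apply: eq_bigr => j _; rewrite /= -mulrDl addcJ mulrA.
- apply: (@mulfI _ (2%:R * 'i%C : C)).
    by rewrite mulf_neq0 ?pnatr_eq0 // eq_complex /= oner_eq0 andbF.
  have e : \sum_j z j * fcoef (g j) n - \sum_j conjc (z j) * fcoef (g j) n = 0.
    by rewrite hz hz' subr0.
  rewrite mulr0 -[RHS]e -sumrB mulr_sumr.
  by apply: eq_bigr => j _; rewrite -mulrBl subcJ mulrA (mulrAC _ 'i%C).
Qed.

End DualEquation.

(** * Proof of the theorem *)

Section ReducibleSolutions.
Local Open Scope classical_set_scope.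
Context {R : realType}.
Local Notation C := R[i].

Lemma orbit_eq0 (alpha : R) m (A : R -> 'M[C]_m) (S : 'M[C]_m) (U : int -> 'cV[C]_m) :
  S \in unitmx -> (forall x, conjT (A x) *m S *m A x = S) ->
  is_orbit alpha m A U -> U 0 = 0 -> forall n, U n = 0.
Proof.
move=> uS AS hU U0; case=> n.
  by rewrite -(orbit_iter_at0 _ _ _ _ _ hU) U0 mulmx0.
apply/eqP; rewrite NegzE -(iter_eq0 alpha m A S uS AS n.+1 (- (n.+1%:R * alpha))).
by rewrite (orbit_iter_to0 _ _ _ _ _ hU) U0.
Qed.

Lemma Jmat_mul_eq0 (y : 'cV[C]_2) : Jmat R *m y = 0 -> y = 0.
Proof.
move=> hy; have h0 := congr1 (fun M : 'cV[C]_2 => M ord0 0) hy.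
have h1 := congr1 (fun M : 'cV[C]_2 => M (lift ord0 ord0) 0) hy.
move: h0 h1; rewrite !mxE !big_ord_recl !big_ord0 !mxE /= => h0 h1.
apply/colP => j; rewrite mxE; case: (unliftP ord0 j) => [j' ->|->].
  by rewrite (ord1 j'); move: h0; rewrite mul0r mul1r add0r addr0.
by move: h1; rewrite mulN1r mul0r !addr0 => /eqP; rewrite oppr_eq0 => /eqP.
Qed.

(** J is invertible, so F^* S F = J leaves no room for a kernel of F. *)
Lemma in_Sp_injective l (wh : int -> C) (F : 'M[R]_(l + l, 2)) (r : 'cV[R]_2) :
  in_Sp wh F -> F *m r = 0 -> r = 0.
Proof.
move=> hF Fr; have : Jmat R *m cmx r = 0.
  rewrite -hF -mulmxA (_ : cmx F *m cmx r = cmx (F *m r)).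
    by rewrite Fr /cmx map_mx0 mulmx0.
  by rewrite /cmx map_mxM.
move/Jmat_mul_eq0 => h; apply/colP => j.
by have := congr1 (fun M : 'cV[C]_2 => M j 0) h; rewrite !mxE => -[].
Qed.

Variables (alpha E : R) (d l : nat) (vh wh : int -> C).
Hypothesis wl0 : wh l%:Z != 0.
Hypothesis vreal : trig_real_valued d vh.
Variable H : R -> 'M[R]_(l + l, 2).
Hypothesis Han : analytic_periodic_mx H.
Hypothesis HSp : forall x, in_Sp wh (H x).
Hypothesis Hcoc : forall x,
  transfer_fun l wh d vh E x *m cmx (H x) = cmx (H (x + alpha)).

(** For l = 0 the product F^* S F is zero, unlike J. *)
Lemma in_Sp_size_gt0 : (0 < l)%N.
Proof.
rewrite lt0n; apply/negP => /eqP l0; have := HSp 0; rewrite /in_Sp.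
move/(congr1 (fun M : 'M[C]_2 => M ord0 (lift ord0 ord0))).
rewrite mxE big1 => [|i _]; last by exfalso; have := ltn_ord i; lia.
by rewrite !mxE /= => /eqP; rewrite eq_sym oner_eq0.
Qed.

(** Rows are indexed by nat, with default value 0, so that shifts of indices stay free of
    ordinals. *)
Definition entry (j : 'I_2) (a : nat) (x : R) : R :=
  if insub a is Some i then H x i j else 0.

Lemma entryE j (i : 'I_(l + l)) x : entry j i x = H x i j.
Proof. by rewrite /entry valK. Qed.

Lemma entry_continuous j a : continuous (entry j a).
Proof.
rewrite /entry; case: (insub a) => [i|]; last by move=> x; exact: cvg_cst.
exact: real_analytic_continuous (Han.2 i j).
Qed.

Lemma entry_periodic j a x : entry j a (x + 1) = entry j a x.
Proof. by rewrite /entry; case: (insub a) => // i; rewrite Han.1. Qed.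

Lemma entry_step j (i : 'I_(l + l)) x (q := complex.Re (trig_eval d vh x)) :
  (entry j i (x + alpha))%:C =
  ((i : nat) == 0%N)%:R *
    (\sum_(a < l + l) (entry j a x)%:C * transfer_row l wh q E a) +
  \sum_(a < l + l) (a.+1 == i)%:R * (entry j a x)%:C.
Proof.
have := congr1 (fun M : 'M[C]_(l + l, 2) => M i j) (Hcoc x).
rewrite /transfer_fun trig_eval_real // -/q mxE [cmx _ _ _]mxE -entryE => <-.
rewrite mulr_sumr -big_split; apply: eq_bigr => a _ /=.
rewrite transferE mxE -entryE mulrDl (eq_sym _ a.+1) -mulrA.
by rewrite (mulrC (transfer_row _ _ _ _ _)).
Qed.

(** Below its first row the transfer matrix copies row a at x to row a + 1 at x + alpha; all rows of
    H are thus translates of one another. *)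
Lemma entry_shift j a k x : (a + k < l + l)%N ->
  entry j (a + k) (x + k%:R * alpha) = entry j a x.
Proof.
elim: k => [|k IH] ak; first by rewrite addn0 mul0r addr0.
have ak' : (a + k < l + l)%N by rewrite (leq_trans _ ak) // addnS.
rewrite -IH // -natr1 mulrDl mul1r addrA addnS.
rewrite addnS in ak; apply: complexI.
have /= := entry_step j (Ordinal ak) (x + k%:R * alpha); rewrite mul0r add0r => ->.
under eq_bigr do rewrite eqSS.
by rewrite (sum_delta _ _ (fun b => (entry j b (x + k%:R * alpha))%:C)) ak'.
Qed.

(** Row l - 1 is the position of index 0 in the state vector. *)
Definition solution (j : 'I_2) : R -> R := entry j l.-1.

Lemma entry_solution j (a : nat) x : (a < l + l)%N ->
  entry j a x = solution j (x + (l%:Z - a.+1%:Z)%:~R * alpha).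
Proof.
move=> al; have l0 := in_Sp_size_gt0; have [h|h] := leqP a l.-1.
  rewrite -(entry_shift j a (l.-1 - a)) ?subnKC //; last lia.
  by have -> : l%:Z - a.+1%:Z = (l.-1 - a)%N%:Z by lia.
have -> : l%:Z - a.+1%:Z = - (a - l.-1)%N%:Z by lia.
rewrite /solution -(entry_shift j l.-1 (a - l.-1)) ?subnKC ?(ltnW h) //.
by rewrite rmorphN mulNr subrK.
Qed.

Lemma solution_eq j : finite_range_eq alpha E d l vh wh (solution j).
Proof.
move=> x; have l0 := in_Sp_size_gt0.
have l1 : (0 < l + l)%N by rewrite addn_gt0 l0.
have /= := entry_step j (Ordinal l1) x; rewrite mul1r [X in _ = _ + X]big1 ?addr0; last first.
  by move=> a _; rewrite mul0r.
move/(congr1 (fun z => wh l%:Z * z)).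
rewrite /= (transfer_row_sum _ _ _ _ (fun a => (entry j a x)%:C)) //.
rewrite big_ord_recl /= subr0 entry_solution // => h.
have hs : \sum_(a < l + l) wh (l%:Z - a.+1%:Z) * (entry j a x)%:C =
    \sum_(b < l + l) wh (l%:Z - (bump 0 b)%:Z) *
      (solution j (x + (l%:Z - (bump 0 b)%:Z)%:~R * alpha))%:C.
  by apply: eq_bigr => b _; rewrite entry_solution.
have e : x + alpha + (l%:Z - 1%:Z)%:~R * alpha = x + l%:Z%:~R * alpha.
  by rewrite rmorphB /=; ring.
rewrite e hs -trig_eval_real // in h.
by rewrite h -/(solution j); ring.
Qed.

End ReducibleSolutions.

Theorem theorem5p1 (R : realType) (alpha E : R) (d l : nat)
  (vh wh : int -> R[i])
  (Halpha : forall q : rat, alpha != ratr q)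
  (Hvd : vh d%:Z != 0) (Hwl : wh l%:Z != 0)
  (Hvreal : trig_real_valued d vh) (Hwreal : trig_real_valued l wh) :
  (exists H : R -> 'M[R]_(l + l, 2),
     analytic_periodic_mx H /\
     (forall x, in_Sp wh (H x)) /\
     (forall x, transfer_fun l wh d vh E x *m cmx (H x) = cmx (H (x + alpha)))) ->
  ~ PH2 alpha (transfer_fun d vh l wh E).
Proof.
move=> [H [Han [HSp Hcoc]]] [dom1 dom2].
have d0 : (0 < d)%N.
  move: dom2 => [Ep [_ [_ [_ [_ [_ [rEp _]]]]]]].
  by have := rank_leq_row (Ep 0); rewrite rEp; case: (d).
have herm := trig_coef_conj d vh Hvreal.
pose S := Smat d vh.
have uS : S \in unitmx by exact: Smat_unit.
have AS x : conjT (transfer_fun d vh l wh E x) *m S *m transfer_fun d vh l wh E x = S.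
  by rewrite /transfer_fun trig_eval_real //; exact: transfer_form.
pose g := solution l H; pose U j := coef_orbit d (g j).
have gc j : continuous (g j) by exact: entry_continuous.
have g1 j x : g j (x + 1) = g j x by exact: entry_periodic.
have geq j : finite_range_eq alpha E d l vh wh (g j) by exact: solution_eq.
have hU j : is_orbit alpha (d + d)%N (transfer_fun d vh l wh E) (U j).
  exact: coef_orbit_is_orbit.
have vU j : vanishes_at_infinity (d + d)%N (U j) by exact: coef_orbit_vanishes.
have := no_vanishing_orbit_pair alpha (d + d)%N _ S uS AS
  (transfer_fun_continuous _ _ _ _ _) (transfer_fun_periodic _ _ _ _ _)
  d U erefl dom1 dom2 hU vU.
(* It remains to show that a dependence z between the two vectors at time 0 is trivial. *)
rewrite -kermx_eq0 => /rowV0Pn[z /sub_kermxP zV /eqP]; apply.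
pose W n := \sum_j z 0 j *: U j n.
have hW : is_orbit alpha (d + d)%N (transfer_fun d vh l wh E) W.
  move=> n; rewrite /W mulmx_sumr; apply: eq_bigr => j _.
  by rewrite hU scalemxAr.
have W0 : W 0 = 0.
  apply: trmx_inj; rewrite trmx0 -zV mulmx_sum_row /W raddf_sum /=.
  by apply: eq_bigr => j _; rewrite linearZ /= rowK.
have Wn := orbit_eq0 _ _ _ _ _ uS AS hW W0.
have hz n : \sum_j z 0 j * fcoef (g j) n = 0.
  (* Coordinate d - 1 of the state vector at time n is the coefficient of index n. *)
  have i0 : (d.-1 < d + d)%N by lia.
  have := congr1 (fun M : 'cV_(d + d) => M (Ordinal i0) 0) (Wn n).
  rewrite /W summxE mxE => {2}<-; apply: eq_bigr => j _.
  by rewrite !mxE /= prednK // subrr addr0.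
have hx := fcoef_combination_eq0 g (fun j => z 0 j) gc g1 hz.
(* Each entry of H at 0 is a value of a solution, so a relation between the solutions holds between
   the columns of H 0. *)
have col_eq0 (r : 'I_2 -> R) : (forall x, \sum_j r j * g j x = 0) -> \col_j r j = 0.
  move=> hr; apply: (in_Sp_injective l wh (H 0) _ (HSp 0)).
  apply/colP => i; rewrite mxE [RHS]mxE.
  rewrite -[RHS](hr (0 + (l%:Z - i.+1%:Z)%:~R * alpha)); apply: eq_bigr => j _.
  rewrite mxE mulrC; congr (_ * _).
  by rewrite -entryE (entry_solution alpha E d l vh wh).
have hre := col_eq0 _ (fun x => (hx x).1).
have him := col_eq0 _ (fun x => (hx x).2).
apply/rowP => j; rewrite mxE; apply/eqP; rewrite eq_complex /=.
have := congr1 (fun M : 'cV[R]_2 => M j 0) hre.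
have := congr1 (fun M : 'cV[R]_2 => M j 0) him.
by rewrite !mxE => -> ->; rewrite !eqxx.
Qed.
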